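(* Let $n$ be a nonzero integer, let $k=\mathbb{Q}(\sqrt n)$ if $n$ is not the square of an integer and $k=\mathbb{Q}\oplus\mathbb{Q}$ otherwise. Let $S(n)=\bigsqcup_{b,c\ge1,\ (bc)^2=n/\Delta_k} S_k(b,c)/\!\sim$ and $L^\vee(n)=\{x\in L^\vee:\mathrm{disc}(x)=-27n\}$. Then the map $\Psi_n:S(n)\to\Gamma\backslash L^\vee(n)$ defined below is a bijection.
   Context: $L$ is the lattice of integral binary cubic forms $x(u,v)=x_0u^3+x_1u^2v+x_2uv^2+x_3v^3$, $x_i\in\mathbb{Z}$; $L^\vee=\{x\in L: x_1,x_2\in3\mathbb{Z}\}$. $\Gamma=SL(2,\mathbb{Z})$ acts by $(\gamma x)(u,v)=x((u,v)\gamma)$. $\mathrm{disc}(x)=x_1^2x_2^2+18x_0x_1x_2x_3-4x_0x_2^3-4x_1^3x_3-27x_0^2x_3^2$. For $k$ as in the claim: $\tau$ is the nontrivial automorphism of $k$ (for $\mathbb{Q}\oplus\mathbb{Q}$ it swaps coordinates, and $\mathbb{Q}$ is embedded diagonally); $\Delta_k$ is the discriminant ($\Delta_{\mathbb{Q}\oplus\mathbb{Q}}=1$); $\sqrt{\Delta_k}$ is the positive square root if $\Delta_k>0$, the square root with positive imaginary part if $\Delta_k<0$, and $(-1,1)$ if $k=\mathbb{Q}\oplus\mathbb{Q}$. $\mathcal{O}_k$ is the maximal order, $\mathcal{O}_{k,c}=\mathbb{Z}\cdot1+c\mathcal{O}_k$. Fractional ideals of an order are rank-2 $\mathbb{Z}$-submodules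 stable under the order; invertible ones have an inverse; $\mathbf N$ is the ideal norm ($[\mathcal{O}:\mathfrak a]$ for integral invertible $\mathfrak a$, extended multiplicatively), and $\mathrm{N}_{k/\mathbb{Q}}$ is the algebra norm. For $b,c\ge1$, $S_k(b,c)$ is the set of pairs $(\mathfrak a,\beta)$ with $\mathfrak a$ an invertible $\mathcal{O}_{k,c}$-ideal, $\beta\in\mathfrak a^3$ and $\mathbf N(\beta\mathfrak a^{-3})=b$; $(\mathfrak a_1,\beta_1)\sim(\mathfrak a_2,\beta_2)$ if there is $\rho\in k^*$ with $\rho\mathfrak a_1=\mathfrak a_2$ and $\rho^3\beta_1=\beta_2$. Definition of $\Psi_n$: for $(\mathfrak a,\beta)\in S_k(b,c)$ with $(bc)^2\Delta_k=n$, choose a $\mathbb{Z}$-basis $\alpha_1,\alpha_2$ of $\mathfrak a$ with $\mathrm{N}_{k/\mathbb{Q}}(\beta)(\alpha_1\alpha_2^\tau-\alpha_2\alpha_1^\tau)/\sqrt{\Delta_k}<0$, and put $x(u,v)=\mathrm{Tr}_{k/\mathbb{Q}}\big(\frac{\beta}{c\sqrt{\Delta_k}\,\mathbf N\mathfrak a^3}(\alpha_1^\tau u+\alpha_2^\tau v)^3\big)$. Then $x\in L^\vee(n)$ and its $\Gamma$-orbit depends only on the class $[\mathfrak a,\beta]$; $\Psi_n$ sends $[\mathfrak a,\beta]$ to this $\Gamma$-orbit. *)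

(* Defs.v *)
From mathcomp Require Import all_boot all_order all_algebra all_field.
From mathcomp Require Import boolp classical_sets functions cardinality.

Set Implicit Arguments.
Unset Strict Implicit.
Unset Printing Implicit Defensive.

Import Order.TTheory GRing.Theory Num.Theory.
Local Open Scope classical_set_scope.
Local Open Scope ring_scope.

(* A binary cubic form x0 u^3 + x1 u^2 v + x2 u v^2 + x3 v^3 over Q; the
   lattice of integral forms is a subset of this space. *)
Record cubic_form := CubicForm { cf0 : rat; cf1 : rat; cf2 : rat; cf3 : rat }.

Definition cf_eval (x : cubic_form) (w : 'rV[rat]_2) : rat :=
  let u := w 0 0 in let v := w 0 1 in
  cf0 x * u ^+ 3 + cf1 x * u ^+ 2 * v + cf2 x * u * v ^+ 2 + cf3 x * v ^+ 3.

Definition cf_disc (x : cubic_form) : rat :=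
  let: CubicForm x0 x1 x2 x3 := x in
  x1 ^+ 2 * x2 ^+ 2 + 18 * x0 * x1 * x2 * x3 - 4 * x0 * x2 ^+ 3
  - 4 * x1 ^+ 3 * x3 - 27 * x0 ^+ 2 * x3 ^+ 2.

Definition Lint : set cubic_form := [set x |
  [/\ cf0 x \is a Num.int, cf1 x \is a Num.int,
      cf2 x \is a Num.int & cf3 x \is a Num.int]].

Definition Ldual : set cubic_form := [set x |
  Lint x /\ (exists m : int, cf1 x = (3 * m)%:~R)
      /\ (exists m : int, cf2 x = (3 * m)%:~R)].

Definition Ldual_n (n : int) : set cubic_form :=
  [set x | Ldual x /\ cf_disc x = (- 27 * n)%:~R].

Definition Gamma : set 'M[int]_2 := [set g | \det g = 1].

(* (g x)(u, v) = x((u, v) g); a form over Q is determined by its values. *)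
Definition Gamma_orbit (x : cubic_form) : set cubic_form := [set y |
  exists2 g, Gamma g &
    forall w, cf_eval y w = cf_eval x (w *m map_mx intr g)].

Definition Gamma_quotient (X : set cubic_form) : set (set cubic_form) :=
  [set Gamma_orbit x | x in X].

(* Two-dimensional commutative Q-algebras, with Q embedded by ratr. *)
Section Arithmetic.
Variable K : comUnitRingType.
Implicit Types (x y : K) (a b O : set K) (e : 'I_2 -> K).

Definition Qcomb e (c : 'rV[rat]_2) : K := \sum_i ratr (c 0 i) * e i.
Definition Zcomb e (c : 'rV[int]_2) : K := \sum_i e i *~ c 0 i.

Definition is_Qbasis e := bijective (Qcomb e).
Definition is_Zbasis e a := injective (Zcomb e) /\ a = range (Zcomb e).

(* Matrix of multiplication by x in some Q-basis of K. *)
Definition mul_matrix x : 'M[rat]_2 :=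
  xget (0 : 'M[rat]_2) [set M : 'M[rat]_2 | exists2 e, is_Qbasis e &
    forall i, x * e i = \sum_j ratr (M i j) * e j].

Definition alg_trace x : rat := \tr (mul_matrix x).
Definition alg_norm x : rat := \det (mul_matrix x).

Definition is_lattice a := exists e, is_Zbasis e a.

Definition is_order O :=
  [/\ is_lattice O, O 1 & forall x y, O x -> O y -> O (x * y)].

Definition max_order : set K :=
  xget set0 [set O | is_order O /\ forall O', is_order O' -> O' `<=` O].

Definition order_c (c : nat) : set K :=
  [set x | exists (m : int) (y : K), max_order y /\ x = m%:~R + c%:R * y].

Definition alg_disc : int :=
  xget 0 [set D : int | exists2 e, is_Zbasis e max_order &
            D%:~R = \det (\matrix_(i, j) alg_trace (e i * e j))].

Definition frac_ideal O a :=
  is_lattice a /\ forall x y, O x -> a y -> a (x * y).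

Definition ideal_mul a b : set K := [set x | exists s : seq (K * K),
  (forall p, p \in s -> a p.1 /\ b p.2) /\ x = \sum_(p <- s) p.1 * p.2].

Definition ideal_cube a := ideal_mul (ideal_mul a a) a.

Definition ideal_scale x a : set K := [set x * y | y in a].

Definition is_inverse O a b := frac_ideal O b /\ ideal_mul a b = O.

Definition invertible O a := frac_ideal O a /\ exists b, is_inverse O a b.

Definition ideal_inv O a : set K := xget set0 [set b | is_inverse O a b].

Definition ideal_index O a : nat :=
  xget 0%N [set m : nat |
    ([set [set x + y | y in a] | x in O] #= `I_m)%card].

Definition integral_invertible O a := invertible O a /\ a `<=` O.

(* N(a) = [O : a1] / [O : a2] whenever a a2 = a1 with a1, a2 integral and
   invertible.  For a not invertible, the value is the default 0. *)
Definition ideal_norm O a : rat :=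
  xget 0 [set r | exists a1 a2,
    [/\ integral_invertible O a1, integral_invertible O a2,
        ideal_mul a a2 = a1 & r = (ideal_index O a1)%:R / (ideal_index O a2)%:R]].

(* Only beta \in K^* gives ideal_norm <> 0. *)
Definition Sset (b c : nat) : set (set K * K) := [set p |
  let O := order_c c in let: (a, beta) := p in
  [/\ invertible O a, ideal_cube a beta
    & ideal_norm O (ideal_scale beta (ideal_cube (ideal_inv O a))) = b%:R]].

Definition Sequiv (p q : set K * K) := exists rho : K,
  [/\ rho \is a GRing.unit, ideal_scale rho p.1 = q.1
    & rho ^+ 3 * p.2 = q.2].

Definition Squot (b c : nat) : set (set (set K * K)) :=
  [set [set q | Sset b c q /\ Sequiv p q] | p in Sset b c].

End Arithmetic.

Record quad_alg := QuadAlg {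
  qcar :> comUnitRingType;
  qconj : qcar -> qcar;
  qsqrtD : qcar  (* the chosen square root of the discriminant *)
}.

Definition split_alg : quad_alg :=
  @QuadAlg (rat * rat)%type (fun x => (x.2, x.1)) (-1, 1).

(* Q(sqrt n), as a number field with an embedding in the algebraic complex
   numbers; sqrtC z is positive for z > 0 and has positive imaginary part for
   z < 0. *)
Definition Qsqrt (n : int) : fieldExtType rat :=
  tag (num_field_exists [:: sqrtC (n%:~R : algC)]).

Definition Qsqrt_emb (n : int) : {rmorphism Qsqrt n -> algC} :=
  tag (tagged (num_field_exists [:: sqrtC (n%:~R : algC)])).

Definition Qsqrt_conj (n : int) : Qsqrt n -> Qsqrt n :=
  @xget (Qsqrt n -> Qsqrt n) idfun [set f : Qsqrt n -> Qsqrt n |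
    [/\ zmod_morphism f, monoid_morphism f, bijective f & f <> idfun]].

Definition Qsqrt_sqrtD (n : int) : Qsqrt n :=
  xget 0 [set d | Qsqrt_emb n d = sqrtC ((alg_disc (Qsqrt n))%:~R : algC)].

Definition field_alg (n : int) : quad_alg :=
  @QuadAlg (Qsqrt n) (@Qsqrt_conj n) (Qsqrt_sqrtD n).

Definition quad_alg_of (n : int) : quad_alg :=
  if `[< exists m : int, n = m ^+ 2 >] then split_alg else field_alg n.

(* The disjoint union is a set of triples (b, c, class). *)
Definition S_n (k : quad_alg) (n : int) : set (nat * nat * set (set k * k)) :=
  [set t | let: (b, c, C) := t in
    [/\ (0 < b)%N, (0 < c)%N, (b * c)%:R ^+ 2 * alg_disc k = n
      & Squot b c C]].

Section Psi.
Variable k : quad_alg.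
Local Notation "x ^t" := (qconj x) (at level 2, format "x ^t").

Definition oriented_basis (a : set k) (beta : k) (e : 'I_2 -> k) :=
  is_Zbasis e a /\
  exists2 q : rat, q < 0 &
    ratr (alg_norm beta) * (e 0 * (e 1)^t - e 1 * (e 0)^t) / qsqrtD k = ratr q.

Definition is_form_of (c : nat) (a : set k) (beta : k) (e : 'I_2 -> k)
    (x : cubic_form) :=
  forall w : 'rV[rat]_2, cf_eval x w =
    alg_trace (beta / (c%:R * qsqrtD k * ratr (ideal_norm (order_c c) a ^+ 3))
               * ((e 0)^t * ratr (w 0 0) + (e 1)^t * ratr (w 0 1)) ^+ 3).

(* The union of the orbits obtained from all representatives (a, beta) of the
   class and all choices of bases; it is a single orbit exactly when the orbit
   does not depend on these choices. *)
Definition Psi (t : nat * nat * set (set k * k)) : set cubic_form :=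
  let: (b, c, C) := t in
  [set y | exists (a : set k) (beta : k) (e : 'I_2 -> k) (x : cubic_form),
     [/\ C (a, beta), oriented_basis a beta e, is_form_of c a beta e x
       & Gamma_orbit x y]].

End Psi.

Arguments S_n : clear implicits.
Arguments Psi : clear implicits.

(* Main.v *)
Require Import Defs.
From HB Require Import structures.
From mathcomp Require Import all_boot all_order all_algebra all_field ring lra zify.
From mathcomp Require Import boolp classical_sets functions cardinality.

Set Implicit Arguments.
Unset Strict Implicit.
Unset Printing Implicit Defensive.
Import Order.TTheory GRing.Theory Num.Theory.
Local Open Scope classical_set_scope.
Local Open Scope ring_scope.

(** Write the quadratic algebra as Q + Q dl with dl = sqrt(Delta).  If a has
    basis e0, e1 and N(e0 u + e1 v) = g (A u^2 + B u v + C v^2) with A, B, C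
    coprime integers, then a * conj a = g (Z + Z e0 conj(e1)/g), so a is an
    invertible O_c-ideal exactly when a * conj a = g O_c, and then N(a) = g and
    the oriented area of the basis is +- g c / 2.  A form
    x = (x0, 3 y1, 3 y2, x3) of the image is Tr(kappa l^3), and its Hessian is
    sgn(N beta) b times the primitive norm form above.  Hence x determines b as
    the content of its Hessian, c by the discriminant, the ratio e1 / e0 as a
    root of the Hessian (the orientation picks one of the two conjugates), and
    beta by two linear equations; this gives injectivity.  Conversely, the
    Hessian of an arbitrary x, made to have nonzero leading coefficient by an
    element of Gamma, provides a and beta by the same formulas, integrality of
    the coefficients of x being dual to beta lying in a^3. *)

(** * Coordinates and lattices in a quadratic algebra *)

(** In Q + Q a nonzero element can have norm 0, so dividing by a basis vector has to be earned. All
    computations therefore take place in rational coordinates, where a unit is an element of nonzero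
    norm and Q + Q is the case D = 1. The quotient e1 / e0 makes sense once the leading coefficient
    of the Hessian is nonzero, since N(e0) is that coefficient up to nonzero factors; for x in
    L^vee(n) it can vanish only if n is a square, and this is why x may first have to be moved
    inside its orbit. The constant -27 is the ratio between disc(x) and the discriminant of the
    Hessian, so the Hessian has discriminant n = (bc)^2 D. The denominator c sqrt(Delta) N(a)^3
    comes from duality: 1/(c sqrt(Delta)) generates the trace dual of O_c, and a conj(a) = g O_c
    then makes conj(a)^3 / (c sqrt(Delta) g^3) the trace dual of a^3, up to sign. Testing beta
    against the four cubic monomials in the conjugate basis gives exactly x0, y1, y2, x3, which is
    why the middle coefficients are divisible by 3. *)

Lemma det_2x2 (R : comPzRingType) (M : 'M[R]_2) :
  \det M = M 0 0 * M 1 1 - M 0 1 * M 1 0.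
Proof.
have e1 : lift 1 0 = 0 :> 'I_2 by apply/val_inj.
have e2 : lift ord0 ord0 = 1 :> 'I_2 by apply/val_inj.
rewrite (expand_det_row _ 0) !big_ord_recl big_ord0 /cofactor !det_mx11 !mxE.
by rewrite !e2 e1 /= addr0 expr0 expr1 mul1r mulN1r mulrN.
Qed.

Lemma common_den (s : seq rat) :
  exists2 d : int, 0 < d & forall q, q \in s -> d%:~R * q \is a Num.int.
Proof.
elim: s => [|q s [d d0 IH]]; first by exists 1.
exists (d * denq q); first by rewrite mulr_gt0 ?denq_gt0.
move=> r; rewrite inE => /orP[/eqP->|/IH H].
  by rewrite intrM -mulrA [_ * q]mulrC -numqE rpredM // intr_int.
by rewrite intrM mulrAC rpredM // intr_int.
Qed.

Lemma big_I2 (V : nmodType) (F : 'I_2 -> V) : \sum_i F i = F 0 + F 1.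
Proof.
by rewrite !big_ord_recl big_ord0 addr0; congr (_ + F _); apply/val_inj.
Qed.

(** An element stands for [re x + im x * sqrt D]. Only the ring laws in coordinates are recorded,
    and [D] may be a square, so one argument serves Q + Q and the quadratic fields. *)
Record quad_coord (K : comUnitRingType) (D : int) := QuadCoord {
  re : K -> rat;
  im : K -> rat;
  mkq : rat -> rat -> K;
  mkqK : forall x, mkq (re x) (im x) = x;
  re_mkq : forall p q, re (mkq p q) = p;
  im_mkq : forall p q, im (mkq p q) = q;
  re1 : re 1 = 1;
  im1 : im 1 = 0;
  reD : forall x y, re (x + y) = re x + re y;
  imD : forall x y, im (x + y) = im x + im y;
  reM : forall x y, re (x * y) = re x * re y + D%:~R * (im x * im y);
  imM : forall x y, im (x * y) = re x * im y + im x * re y }.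

Section Coord.
Variables (K : comUnitRingType) (D : int) (C : quad_coord K D).
Local Notation re := (re C).
Local Notation im := (im C).
Local Notation mkq := (mkq C).
Implicit Types (x y z : K) (p q : rat).

Lemma eq_coord x y : re x = re y -> im x = im y -> x = y.
Proof. by move=> rxy ixy; rewrite -(mkqK C x) -(mkqK C y) rxy ixy. Qed.

Lemma re0 : re 0 = 0.
Proof. by apply: (@addrI _ (re 0)); rewrite -reD !addr0. Qed.
Lemma im0 : im 0 = 0.
Proof. by apply: (@addrI _ (im 0)); rewrite -imD !addr0. Qed.
Lemma reN x : re (- x) = - re x.
Proof. by apply: (@addrI _ (re x)); rewrite -reD !subrr re0. Qed.
Lemma imN x : im (- x) = - im x.
Proof. by apply: (@addrI _ (im x)); rewrite -imD !subrr im0. Qed.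
Lemma re_natr n : re n%:R = n%:R.
Proof. by elim: n => [|n IH]; rewrite ?re0 // -addn1 !natrD reD IH re1. Qed.
Lemma im_natr n : im n%:R = 0.
Proof. by elim: n => [|n IH]; rewrite ?im0 // -addn1 !natrD imD IH im1 addr0. Qed.
Lemma re_intr (m : int) : re m%:~R = m%:~R.
Proof.
by case: m => n; rewrite ?NegzE ?mulrNz ?reN -!pmulrn re_natr.
Qed.
Lemma im_intr (m : int) : im m%:~R = 0.
Proof.
by case: m => n; rewrite ?NegzE ?mulrNz ?imN -!pmulrn im_natr ?oppr0.
Qed.
Lemma reX2 x : re (x ^+ 2) = re x ^+ 2 + D%:~R * im x ^+ 2.
Proof. by rewrite expr2 reM -!expr2. Qed.
Lemma imX2 x : im (x ^+ 2) = re x * im x *+ 2.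
Proof. by rewrite expr2 imM mulrC -mulr2n. Qed.
Lemma reX3 x : re (x ^+ 3) = re x ^+ 3 + 3 * D%:~R * re x * im x ^+ 2.
Proof. by rewrite exprS reM reX2 imX2; ring. Qed.
Lemma imX3 x : im (x ^+ 3) = 3 * re x ^+ 2 * im x + D%:~R * im x ^+ 3.
Proof. by rewrite exprS imM reX2 imX2; ring. Qed.

Definition qnorm x : rat := re x ^+ 2 - D%:~R * im x ^+ 2.
Definition conj x : K := mkq (re x) (- im x).
Definition inv x : K := mkq (re x / qnorm x) (- im x / qnorm x).

Lemma re_conj x : re (conj x) = re x. Proof. exact: re_mkq. Qed.
Lemma im_conj x : im (conj x) = - im x. Proof. exact: im_mkq. Qed.

Lemma nrmM x y : qnorm (x * y) = qnorm x * qnorm y.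
Proof. by rewrite /qnorm reM imM; ring. Qed.

Lemma inv_mul x : qnorm x != 0 -> x * inv x = 1.
Proof.
move=> nx; apply: eq_coord; rewrite ?reM ?imM ?re_mkq ?im_mkq ?re1 ?im1.
  by move: nx; rewrite /qnorm => nx; field.
by move: nx; rewrite /qnorm => nx; field.
Qed.

Lemma unit_nrm x : (x \is a GRing.unit) = (qnorm x != 0).
Proof.
apply/idP/idP => [ux|nx]; last by apply/unitrPr; exists (inv x); apply: inv_mul.
apply: contra_eqN (congr1 qnorm (divrr ux)) => /eqP n0.
by rewrite nrmM n0 mul0r /qnorm re1 im1 !expr2 !mulr0 subr0 mul1r eq_sym oner_eq0.
Qed.

Lemma inv_coord x : qnorm x != 0 -> x^-1 = inv x.
Proof.
move=> nx; have ux : x \is a GRing.unit by rewrite unit_nrm.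
by rewrite -[inv x]mul1r -(mulVr ux) -mulrA inv_mul // mulr1.
Qed.

Lemma nrm_intr (m : int) : qnorm m%:~R = m%:~R ^+ 2.
Proof. by rewrite /qnorm re_intr im_intr; ring. Qed.

(** In a mere unit ring [ratr] is a quotient of two integers and not yet a morphism; its coordinates
    come from the explicit inverse of the denominator. *)
Lemma re_ratr q : re (ratr q) = q.
Proof.
have d0 : (denq q)%:~R != 0 :> rat by rewrite intr_eq0 denq_neq0.
rewrite /ratr reM re_intr im_intr inv_coord ?nrm_intr ?sqrf_eq0 //.
rewrite re_mkq im_mkq re_intr im_intr nrm_intr mul0r mulr0 addr0.
by rewrite -[RHS]divq_num_den; field.
Qed.

Lemma im_ratr q : im (ratr q) = 0.
Proof.
have d0 : (denq q)%:~R != 0 :> rat by rewrite intr_eq0 denq_neq0.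
rewrite /ratr imM re_intr im_intr inv_coord ?nrm_intr ?sqrf_eq0 //.
by rewrite im_mkq im_intr oppr0 mul0r mul0r mulr0 addr0.
Qed.

(** Rewriting with this family turns an equation in [K] into rational identities within reach of
    [ring], [field] and [lra]. *)
Definition cE := (reD C, imD C, reM C, imM C, re1 C, im1 C, re_mkq C, im_mkq C,
  re0, im0, reN, imN, re_natr, im_natr, re_intr, im_intr, reX2, imX2, reX3, imX3,
  re_conj, im_conj, re_ratr, im_ratr).

(** Since [x * conj y - y * conj x] is [-2 * area x y] times sqrt D, this determinant carries both
    the independence and the orientation of a basis. *)
Definition area x y : rat := re x * im y - im x * re y.

Definition lat (a b : K) : set K :=
  [set x | exists m n : int, x = m%:~R * a + n%:~R * b].

Lemma Zcomb_E (e : 'I_2 -> K) (c : 'rV[int]_2) :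
  Zcomb e c = (c 0 0)%:~R * e 0 + (c 0 1)%:~R * e 1.
Proof. by rewrite /Zcomb big_I2 -(mulrzl (e 0)) -(mulrzl (e 1)). Qed.

Lemma Qcomb_E (e : 'I_2 -> K) (c : 'rV[rat]_2) :
  Qcomb e c = ratr (c 0 0) * e 0 + ratr (c 0 1) * e 1.
Proof. by rewrite /Qcomb big_I2. Qed.

Definition row2 (R : Type) (a b : R) : 'rV[R]_2 := \row_j (if j == 0 then a else b).

Lemma row2_0 (R : Type) (a b : R) : row2 a b 0 0 = a.
Proof. by rewrite mxE eqxx. Qed.
Lemma row2_1 (R : Type) (a b : R) : row2 a b 0 1 = b.
Proof. by rewrite mxE. Qed.
Lemma row2_ext (R : Type) (c d : 'rV[R]_2) :
  c 0 0 = d 0 0 -> c 0 1 = d 0 1 -> c = d.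
Proof.
move=> h0 h1; apply/rowP => -[[|[|//]] lt]; first by move: h0; congr (_ = _); congr (_ _ _); apply/val_inj.
by move: h1; congr (_ = _); congr (_ _ _); apply/val_inj.
Qed.

(** A vanishing determinant gives a rational relation, and clearing denominators makes it integral;
    injectivity of [Zcomb] or [Qcomb] thus becomes a nonzero area. *)
Lemma area0_dep (e : 'I_2 -> K) : area (e 0) (e 1) = 0 ->
  exists c : 'rV[int]_2, c != 0 /\ Zcomb e c = 0.
Proof.
move=> a0.
have [p [q [pq h]]] : exists p q, (p != 0) || (q != 0) /\
    ratr p * e 0 + ratr q * e 1 = 0.
  move: a0; rewrite /area => a0.
  have [r0|r0] := eqVneq (re (e 0)) 0; last first.
    exists (re (e 1)), (- re (e 0)); split; first by rewrite oppr_eq0 r0 orbT.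
    by apply: eq_coord; rewrite !cE; [ring | lra].
  have [i0|i0] := eqVneq (im (e 0)) 0; last first.
    exists (im (e 1)), (- im (e 0)); split; first by rewrite oppr_eq0 i0 orbT.
    by apply: eq_coord; rewrite !cE; [lra | ring].
  exists 1, 0; split; first by rewrite oner_eq0.
  by apply: eq_coord; rewrite !cE ?r0 ?i0; ring.
have [d d0 hd] := common_den [:: p; q].
have /intrP[m hm] : d%:~R * p \is a Num.int by apply: hd; rewrite inE eqxx.
have /intrP[n hn] : d%:~R * q \is a Num.int by apply: hd; rewrite !inE eqxx orbT.
have dn : d%:~R != 0 :> rat by rewrite intr_eq0 gt_eqF.
exists (row2 m n); split.
  apply: contraTneq pq => /rowP mn.
  have /eqP := mn 0; rewrite row2_0 mxE => /eqP m0.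
  have /eqP := mn 1; rewrite row2_1 mxE => /eqP n0.
  move: hm hn; rewrite m0 n0 => /eqP; rewrite mulf_eq0 (negbTE dn) /= => ->.
  by move=> /eqP; rewrite mulf_eq0 (negbTE dn) /= => ->.
rewrite Zcomb_E row2_0 row2_1.
transitivity (d%:~R * (ratr p * e 0 + ratr q * e 1)); last by rewrite h mulr0.
by apply: eq_coord; rewrite !cE -?hm -?hn; ring.
Qed.

Lemma lat_inj (a b : K) (m n m' n' : int) : area a b != 0 ->
  m%:~R * a + n%:~R * b = m'%:~R * a + n'%:~R * b -> m = m' /\ n = n'.
Proof.
move=> ab0 h; have := congr1 re h; have := congr1 im h; rewrite !cE => hi hr.
split; apply/eqP; rewrite -(eqr_int rat); apply/eqP/(mulIf ab0); rewrite /area.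
  have : (m%:~R - m'%:~R) * re a + (n%:~R - n'%:~R) * re b = 0 by lra.
  have : (m%:~R - m'%:~R) * im a + (n%:~R - n'%:~R) * im b = 0 by lra.
  move=> /(congr1 ( *%R (re b))) h1 /(congr1 ( *%R (im b))) h2; lra.
have : (m%:~R - m'%:~R) * re a + (n%:~R - n'%:~R) * re b = 0 by lra.
have : (m%:~R - m'%:~R) * im a + (n%:~R - n'%:~R) * im b = 0 by lra.
move=> /(congr1 ( *%R (re a))) h1 /(congr1 ( *%R (im a))) h2; lra.
Qed.

Lemma range_Zcomb (e : 'I_2 -> K) : range (Zcomb e) = lat (e 0) (e 1).
Proof.
rewrite eqEsubset; split => [_ [c _ <-]|_ [m [n ->]]].
  by rewrite Zcomb_E; exists (c 0 0), (c 0 1).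
by exists (row2 m n) => //; rewrite Zcomb_E row2_0 row2_1.
Qed.

Lemma Zbasis_E (e : 'I_2 -> K) (a : set K) :
  is_Zbasis e a <-> area (e 0) (e 1) != 0 /\ a = lat (e 0) (e 1).
Proof.
rewrite /is_Zbasis range_Zcomb; split=> -[h ->]; split=> //.
  apply/eqP => /area0_dep[c [/eqP c0 hc]]; apply: c0; apply: h; rewrite hc.
  by rewrite Zcomb_E !mxE; ring.
move=> c d; rewrite !Zcomb_E => /(lat_inj h)[h0 h1]; exact: row2_ext.
Qed.

Definition vec2 (a b : K) : 'I_2 -> K := fun i => if i == 0 then a else b.

Lemma is_lattice_E (a : set K) :
  is_lattice a <-> exists e0 e1, area e0 e1 != 0 /\ a = lat e0 e1.
Proof.
split=> [[e /Zbasis_E h]|[e0 [e1 h]]]; first by exists (e 0), (e 1).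
by exists (vec2 e0 e1); apply/Zbasis_E.
Qed.

Lemma Qbasis_area (e : 'I_2 -> K) : is_Qbasis e -> area (e 0) (e 1) != 0.
Proof.
move=> /bij_inj inj; apply/eqP => /area0_dep[c [/eqP c0 hc]]; apply: c0.
have h : map_mx intr c = 0 :> 'rV[rat]_2.
  apply: inj; rewrite !Qcomb_E !mxE -[RHS]addr0 -hc Zcomb_E.
  by apply: eq_coord; rewrite !cE; ring.
apply/rowP => j; have /rowP/(_ j)/eqP := h.
by rewrite !mxE intr_eq0 => /eqP.
Qed.

Lemma std_Qbasis : is_Qbasis (vec2 1 (mkq 0 1)).
Proof.
exists (fun x => row2 (re x) (im x)) => [c|x].
  apply: row2_ext; rewrite ?row2_0 ?row2_1 Qcomb_E /vec2 /= !cE; ring.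
by rewrite Qcomb_E row2_0 row2_1 /vec2 /=; apply: eq_coord; rewrite !cE; ring.
Qed.

Lemma mul_matrixP x : exists2 e, is_Qbasis e &
  forall i, x * e i = \sum_j ratr (mul_matrix x i j) * e j.
Proof.
rewrite /mul_matrix; apply: (@xgetPex _ 0 [set M : 'M[rat]_2 | exists2 e, is_Qbasis e &
    forall i, x * e i = \sum_j ratr (M i j) * e j]).
exists (\matrix_(i, j) if i == 0 then if j == 0 then re x else im x
        else if j == 0 then D%:~R * im x else re x).
exists (vec2 1 (mkq 0 1)); first exact: std_Qbasis.
move=> i; rewrite big_I2 !mxE /vec2 /=.
by case: (i == 0); apply: eq_coord; rewrite !cE; ring.
Qed.

(** Cramer's rule determines the matrix, so the basis chosen inside [mul_matrix] does not matter.
    Applied to a basis of an order, where the matrix is integral, it also yields integrality of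
    trace and norm. *)
Lemma tr_det_basis x (e0 e1 : K) (m00 m01 m10 m11 : rat) :
  area e0 e1 != 0 ->
  x * e0 = ratr m00 * e0 + ratr m01 * e1 ->
  x * e1 = ratr m10 * e0 + ratr m11 * e1 ->
  m00 + m11 = 2 * re x /\ m00 * m11 - m01 * m10 = qnorm x.
Proof.
move=> a0 /[dup] /(congr1 re) + /(congr1 im) + /[dup] /(congr1 re) + /(congr1 im).
move: a0; rewrite /area /qnorm !cE; set p0 := re e0; set p1 := re e1.
set q0 := im e0; set q1 := im e1; set a := re x; set b := im x.
move=> a0 h3 h4 h1 h2.
have E00 : m00 = ((a * p0 + D%:~R * (b * q0)) * q1 - (a * q0 + b * p0) * p1) /
   (p0 * q1 - q0 * p1) by rewrite h3 h4; field.
have E01 : m01 = (p0 * (a * q0 + b * p0) - q0 * (a * p0 + D%:~R * (b * q0))) /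
   (p0 * q1 - q0 * p1) by rewrite h3 h4; field.
have E10 : m10 = ((a * p1 + D%:~R * (b * q1)) * q1 - (a * q1 + b * p1) * p1) /
   (p0 * q1 - q0 * p1) by rewrite h1 h2; field.
have E11 : m11 = (p0 * (a * q1 + b * p1) - q0 * (a * p1 + D%:~R * (b * q1))) /
   (p0 * q1 - q0 * p1) by rewrite h1 h2; field.
by rewrite E00 E01 E10 E11; split; field.
Qed.

Lemma mul_matrix_tr_det x : alg_trace x = 2 * re x /\ alg_norm x = qnorm x.
Proof.
rewrite /alg_trace /alg_norm det_2x2 /mxtrace big_I2.
have [e /Qbasis_area a0 h] := mul_matrixP x.
by apply: (tr_det_basis a0); rewrite h big_I2.
Qed.

Lemma alg_trace_E x : alg_trace x = 2 * re x.
Proof. by case: (mul_matrix_tr_det x). Qed.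
Lemma alg_norm_E x : alg_norm x = qnorm x.
Proof. by case: (mul_matrix_tr_det x). Qed.

End Coord.

(** * Maximal order, discriminant and products of modules *)

(** The last clause says that an element p + q sqrt D of integral trace and norm is an integral
    combination of 1 and (D + sqrt D)/2, with coefficients p - Dq and 2q: the order spanned by these
    two is maximal. *)
Definition fundamental (D : int) : Prop :=
  [/\ D != 0, exists k : int, D * (D - 1) = 4 * k &
    forall p q : rat, 2 * p \is a Num.int -> p ^+ 2 - D%:~R * q ^+ 2 \is a Num.int ->
      2 * q \is a Num.int /\ p - D%:~R * q \is a Num.int].

Section Orders.
Variables (K : comUnitRingType) (D : int) (C : quad_coord K D).
Hypothesis Dfund : fundamental D.
Local Notation re := (re C).
Local Notation im := (im C).
Local Notation mkq := (mkq C).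
Local Notation nrm := (qnorm C).
Local Notation conj := (conj C).
Local Notation areaC := (area C).
Implicit Types (x y z : K) (q : rat) (a b S : set K).

Lemma disc_neq0 : D%:~R != 0 :> rat.
Proof. by case: Dfund => D0 _ _; rewrite intr_eq0. Qed.

Definition om : K := mkq (D%:~R / 2) (1 / 2).

Lemma lat_change (a b a' b' : K) : lat a b = lat a' b' -> areaC a b != 0 ->
  exists m n p q : int, [/\ a' = m%:~R * a + n%:~R * b,
    b' = p%:~R * a + q%:~R * b & (m * q - n * p) ^+ 2 = 1].
Proof.
move=> hl a0.
have [m [n ha']] : lat a b a' by rewrite hl; exists 1, 0; ring.
have [p [q hb']] : lat a b b' by rewrite hl; exists 0, 1; ring.
have [m' [n' ha]] : lat a' b' a by rewrite -hl; exists 1, 0; ring.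
have [p' [q' hb]] : lat a' b' b by rewrite -hl; exists 0, 1; ring.
exists m, n, p, q; split=> //.
(* Going to the other basis and back multiplies the nonzero area by the product of the two
   determinants. *)
have : (m' * q' - n' * p') * (m * q - n * p) = 1.
  apply/eqP; rewrite -(eqr_int rat); apply/eqP/(mulIf a0).
  rewrite mul1r {1}/area [in RHS]/area [in RHS]ha [in RHS]hb ha' hb' !cE; ring.
move/(congr1 absz); rewrite abszM => /eqP; rewrite muln_eq1 => /andP[_ /eqP h].
have [->|->] // : m * q - n * p = 1 \/ m * q - n * p = -1 by lia.
Qed.

Lemma mem_Oc (c : nat) x : (0 < c)%N -> lat 1 (c%:R * om) x <->
  (exists k : int, 2 * im x = c%:R * k%:~R) /\ re x - D%:~R * im x \is a Num.int.
Proof.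
move=> c0; split=> [[m [n ->]]|[[k hk] /intrP[m hm]]].
  split; first by exists n; rewrite !cE; field.
  by apply/intrP; exists m; rewrite !cE; field.
exists m, k; have hi : im x = c%:R * k%:~R / 2 by rewrite -hk; field.
apply: (@eq_coord _ _ C); rewrite !cE; last by rewrite hi; field.
have -> : re x = m%:~R + D%:~R * im x by rewrite -hm; ring.
by rewrite hi; field.
Qed.

Lemma area_om : areaC 1 om = 1 / 2.
Proof. by rewrite /area !cE; field. Qed.

Lemma om_sq : exists k : int, om * om = D%:~R * om - k%:~R.
Proof.
case: Dfund => _ [k hk] _; exists k.
have hkQ : D%:~R * (D%:~R - 1) = 4 * k%:~R :> rat by rewrite -(intrM rat 4) -hk intrM rmorphB.
have -> : k%:~R = ratr (D%:~R * (D%:~R - 1) / 4) :> K.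
  by apply: (@eq_coord _ _ C); rewrite !cE // hkQ; field.
by apply: (@eq_coord _ _ C); rewrite !cE; field.
Qed.

Lemma maxorder_is_order : is_order (lat 1 om).
Proof.
split; first by apply/(is_lattice_E C); exists 1, om; rewrite area_om.
  by exists 1, 0; ring.
move=> _ _ [m [n ->]] [m' [n' ->]]; have [k hk] := om_sq.
exists (m * m' - n * n' * k), (m * n' + n * m' + n * n' * D).
rewrite !(intrM, intrD, rmorphB) /=.
transitivity (m%:~R * m'%:~R + (m%:~R * n'%:~R + n%:~R * m'%:~R) * om
  + n%:~R * n'%:~R * (om * om)); first by ring.
by rewrite hk; ring.
Qed.

(** Multiplication by an element of an order maps a basis of the order into integral combinations of
    itself. *)
Lemma order_integral O x : is_order O -> O x ->
  2 * re x \is a Num.int /\ nrm x \is a Num.int.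
Proof.
move=> [/(is_lattice_E C)[e0 [e1 [a0 ->]]] _ hM] Ox.
have [m [n h0]] : lat e0 e1 (x * e0) by apply: hM => //; exists 1, 0; ring.
have [p [q h1]] : lat e0 e1 (x * e1) by apply: hM => //; exists 0, 1; ring.
have [] := @tr_det_basis _ _ C x e0 e1 m%:~R n%:~R p%:~R q%:~R a0; rewrite ?ratr_int //.
by move=> <- <-; rewrite -!intrM -rmorphB -rmorphD !intr_int.
Qed.

Lemma max_order_E : @max_order K = lat 1 om.
Proof.
have sub O : is_order O -> O `<=` lat 1 om.
  move=> hO x /(order_integral hO)[h1 h2]; have := (@mem_Oc 1 x isT).2.
  rewrite mulr1n mul1r; apply.
  case: Dfund => _ _ /(_ _ _ h1 h2)[/intrP[k hk] ?].
  by split=> //; exists k; rewrite hk mul1r.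
apply: xget_unique; first by split; [exact: maxorder_is_order | exact: sub].
by move=> O [hO max]; rewrite eqEsubset; split; [exact: sub | apply: max maxorder_is_order].
Qed.

Lemma order_c_E c : @order_c K c = lat 1 (c%:R * om).
Proof.
rewrite eqEsubset /order_c max_order_E; split=> [_ [m [_ [[p [q ->]] ->]]]|_ [m [n ->]]].
  by exists (m + p * c%:Z), q; rewrite intrD intrM -pmulrn; ring.
by exists m, (n%:~R * om); split; [exists 0, n; ring | ring].
Qed.

(** The trace form has determinant 4 D area^2 in every basis, the area of (1, [om]) is 1/2, and a
    change of basis of the maximal order preserves the square of the area. *)
Lemma alg_disc_E : alg_disc K = D.
Proof.
pose disc (e : 'I_2 -> K) : rat := \det (\matrix_(i < 2, j < 2) alg_trace (e i * e j)).
have discE (e : 'I_2 -> K) : disc e = 4 * D%:~R * areaC (e 0) (e 1) ^+ 2.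
  by rewrite /disc det_2x2 !mxE !(alg_trace_E C) /area !cE; ring.
apply: xget_unique => [|D' [e /(Zbasis_E C)[a0 +] hD']].
  exists (vec2 1 om).
    by apply/(Zbasis_E C); rewrite /vec2 /= area_om max_order_E.
  by rewrite -[RHS]/(disc _) discE /vec2 /= area_om; field.
move: hD'; rewrite -[X in _ = X]/(disc e) discE max_order_E => hD' /esym h.
have [m [n [p [q [e1 e2 hdet]]]]] := lat_change h a0.
have : (m%:~R * q%:~R - n%:~R * p%:~R) ^+ 2 = 1 :> rat.
  by rewrite -!intrM -rmorphB -rmorphXn hdet.
have := area_om; rewrite e1 e2 => h1 h2.
have : areaC (e 0) (e 1) ^+ 2 = 1 / 4.
  transitivity ((1 / 2) ^+ 2 : rat); last by field.
  rewrite -h1; transitivity ((m%:~R * q%:~R - n%:~R * p%:~R) ^+ 2 * areaC (e 0) (e 1) ^+ 2).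
    by rewrite h2 mul1r.
  by rewrite /area !cE; ring.
move=> h3; apply/eqP; rewrite -(eqr_int rat) hD' h3; apply/eqP; by field.
Qed.

(** * Additive subgroups, products of modules and conjugation *)

Definition zsub S := S 0 /\ forall x y, S x -> S y -> S (x - y).

Lemma zsubN S x : zsub S -> S x -> S (- x).
Proof. by move=> [S0 SB] Sx; rewrite -sub0r; apply: SB. Qed.
Lemma zsubD S x y : zsub S -> S x -> S y -> S (x + y).
Proof. by move=> hS Sx Sy; rewrite -[y]opprK; apply: hS.2 => //; apply: zsubN. Qed.
Lemma zsub_sum S (I : eqType) (s : seq I) (F : I -> K) : zsub S ->
  (forall i, i \in s -> S (F i)) -> S (\sum_(i <- s) F i).
Proof.
move=> hS; elim: s => [|i s IH] h; first by rewrite big_nil; case: hS.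
rewrite big_cons; apply: zsubD => //; first by apply: h; rewrite inE eqxx.
by apply: IH => j js; apply: h; rewrite inE js orbT.
Qed.
Lemma zsubMn S x n : zsub S -> S x -> S (n%:R * x).
Proof.
move=> hS Sx; elim: n => [|n IH]; first by rewrite mul0r; case: hS.
by rewrite -natr1 mulrDl mul1r; apply: zsubD.
Qed.
Lemma zsubMz S x (m : int) : zsub S -> S x -> S (m%:~R * x).
Proof.
move=> hS Sx; case: m => n; first exact: zsubMn.
by rewrite NegzE mulrNz mulNr; apply: zsubN => //; apply: zsubMn.
Qed.

Lemma lat_zsub (e0 e1 : K) : zsub (lat e0 e1).
Proof.
split; first by exists 0, 0; ring.
move=> _ _ [m [n ->]] [p [q ->]]; exists (m - p), (n - q).
by rewrite !rmorphB /=; ring.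
Qed.

Lemma lat_sub (e0 e1 : K) S : zsub S -> S e0 -> S e1 -> lat e0 e1 `<=` S.
Proof. by move=> hS h0 h1 _ [m [n ->]]; apply: zsubD => //; apply: zsubMz. Qed.

Lemma lattice_zsub a : is_lattice a -> zsub a.
Proof. by move=> /(is_lattice_E C)[e0 [e1 [_ ->]]]; apply: lat_zsub. Qed.

Lemma lat_l (e0 e1 : K) : lat e0 e1 e0. Proof. by exists 1, 0; ring. Qed.
Lemma lat_r (e0 e1 : K) : lat e0 e1 e1. Proof. by exists 0, 1; ring. Qed.

Lemma imul_mem a b x y : a x -> b y -> ideal_mul a b (x * y).
Proof.
move=> ax by_; exists [:: (x, y)]; split; last by rewrite big_seq1.
by move=> p; rewrite inE => /eqP->.
Qed.

(** Elements of [ideal_mul] are finite sums, so an inclusion into a subgroup may be tested on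
    products. All later arguments about products of ideals go through this test. *)
Lemma imul_sub a b S : zsub S -> (forall x y, a x -> b y -> S (x * y)) ->
  ideal_mul a b `<=` S.
Proof.
move=> hS h _ [s [hs ->]]; apply: zsub_sum => // p /hs[? ?]; exact: h.
Qed.

Lemma imul_zsub a b : zsub a -> zsub (ideal_mul a b).
Proof.
move=> ha; split; first by exists [::]; split=> //; rewrite big_nil.
move=> _ _ [s [hs ->]] [t [ht ->]]; exists (s ++ [seq (- p.1, p.2) | p <- t]).
split=> [p|].
  rewrite mem_cat => /orP[/hs //|/mapP[r /ht[? ?] ->]] /=; split=> //; exact: zsubN.
rewrite big_cat big_map -sumrN; congr (_ + _); apply: eq_bigr => p _ /=.
by rewrite mulNr.
Qed.

Lemma imulC a b : ideal_mul a b = ideal_mul b a.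
Proof.
suff h (u v : set K) : ideal_mul u v `<=` ideal_mul v u by rewrite eqEsubset; split; apply: h.
move=> _ [s [hs ->]]; exists [seq (p.2, p.1) | p <- s]; split.
  by move=> p /mapP[r /hs[? ?] ->].
by rewrite big_map; apply: eq_bigr => p _; rewrite mulrC.
Qed.

Lemma imulA a b c : zsub a -> zsub b -> zsub c ->
  ideal_mul a (ideal_mul b c) = ideal_mul (ideal_mul a b) c.
Proof.
suff h (u v w : set K) : zsub u -> zsub v -> zsub w ->
    ideal_mul u (ideal_mul v w) `<=` ideal_mul (ideal_mul u v) w.
  move=> ha hb hc; rewrite eqEsubset; split; first exact: h.
  rewrite (imulC a b) (imulC (ideal_mul b a)) (imulC a (ideal_mul b c)) (imulC b c).
  exact: h.
move=> hu hv hw; have hz : zsub (ideal_mul (ideal_mul u v) w) by do 2!apply: imul_zsub.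
apply: imul_sub => // x y ux.
(* For fixed [x], the elements whose product with [x] lies in a subgroup form a subgroup again, so
   the test on products applies once more. The same device recurs below. *)
suff : ideal_mul v w `<=` [set y | ideal_mul (ideal_mul u v) w (x * y)] by apply.
apply: imul_sub => [|s t vs wt].
  split=> /=; first by rewrite mulr0; case: hz.
  by move=> y1 y2 h1 h2; rewrite mulrBr; apply: hz.2.
by rewrite /= mulrA; apply: imul_mem => //; apply: imul_mem.
Qed.

Lemma scale_zsub x a : zsub a -> zsub (ideal_scale x a).
Proof.
move=> [a0 aB]; split; first by exists 0 => //; rewrite mulr0.
by move=> _ _ [y ay <-] [z az <-]; exists (y - z); [exact: aB | rewrite mulrBr].
Qed.

Lemma scaleA x y a : ideal_scale x (ideal_scale y a) = ideal_scale (x * y) a.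
Proof.
rewrite eqEsubset; split=> [_ [_ [z az <-] <-]|_ [z az <-]].
  by exists z => //; rewrite mulrA.
by exists (y * z); [exists z | rewrite mulrA].
Qed.

Lemma scale1 a : ideal_scale 1 a = a.
Proof. by rewrite /ideal_scale; under eq_fun do rewrite mul1r; rewrite image_id. Qed.

Lemma scale_imul x a b : ideal_mul (ideal_scale x a) b = ideal_scale x (ideal_mul a b).
Proof.
rewrite eqEsubset; split=> [_ [s [hs ->]]|_ [_ [s [hs ->]] <-]].
  have [t ht] : exists t : seq (K * K), (forall p, p \in t -> a p.1 /\ b p.2) /\
      \sum_(p <- s) p.1 * p.2 = x * \sum_(p <- t) p.1 * p.2.
    elim: s hs => [|p s IH] h; first by exists [::]; rewrite !big_nil mulr0.
    have [t [ht et]] : exists t : seq (K * K), (forall p, p \in t -> a p.1 /\ b p.2) /\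
      \sum_(p <- s) p.1 * p.2 = x * \sum_(p <- t) p.1 * p.2.
      by apply: IH => q qs; apply: h; rewrite inE qs orbT.
    have [[y ay hy] bp] : ideal_scale x a p.1 /\ b p.2 by apply: h; rewrite inE eqxx.
    exists ((y, p.2) :: t); split=> [q|]; first by rewrite inE => /orP[/eqP->|/ht].
    by rewrite !big_cons et mulrDr -hy mulrA.
  by rewrite ht.2; exists (\sum_(p <- t) p.1 * p.2) => //; exists t; split=> //; apply: ht.1.
exists [seq (x * p.1, p.2) | p <- s]; split.
  by move=> p /mapP[q /hs[? ?] ->]; split=> //; exists q.1.
by rewrite big_map mulr_sumr; apply: eq_bigr => p _; rewrite mulrA.
Qed.

Lemma scale_imulr x a b : ideal_mul a (ideal_scale x b) = ideal_scale x (ideal_mul a b).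
Proof. by rewrite imulC scale_imul imulC. Qed.

Lemma scale_lat x e0 e1 : ideal_scale x (lat e0 e1) = lat (x * e0) (x * e1).
Proof.
rewrite eqEsubset; split=> [_ [_ [m [n ->]] <-]|_ [m [n ->]]].
  by exists m, n; ring.
by exists (m%:~R * e0 + n%:~R * e1); [exists m, n | ring].
Qed.

Lemma conjD x y : conj (x + y) = conj x + conj y.
Proof. by apply: (@eq_coord _ _ C); rewrite !cE //; ring. Qed.
Lemma conjM x y : conj (x * y) = conj x * conj y.
Proof. by apply: (@eq_coord _ _ C); rewrite !cE //; ring. Qed.
Lemma conjK x : conj (conj x) = x.
Proof. by apply: (@eq_coord _ _ C); rewrite !cE //; ring. Qed.
Lemma conj_ratr q : conj (ratr q) = ratr q.
Proof. by apply: (@eq_coord _ _ C); rewrite !cE //; ring. Qed.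
Lemma conj_int (m : int) : conj m%:~R = m%:~R.
Proof. by rewrite -ratr_int conj_ratr. Qed.
Lemma conjN x : conj (- x) = - conj x.
Proof. by apply: (@eq_coord _ _ C); rewrite !cE //; ring. Qed.

Lemma mul_conj x : x * conj x = ratr (nrm x).
Proof. by apply: (@eq_coord _ _ C); rewrite /nrm !cE; ring. Qed.

Definition cj a : set K := conj @` a.

Lemma cjE a x : cj a x <-> a (conj x).
Proof. by split=> [[y ay <-]|ax]; [rewrite conjK | exists (conj x) => //; rewrite conjK]. Qed.

Lemma cjK a : cj (cj a) = a.
Proof. by rewrite eqEsubset; split=> x; rewrite !cjE conjK. Qed.

Lemma cj_zsub a : zsub a -> zsub (cj a).
Proof.
move=> [a0 aB]; split; first by apply/cjE; rewrite -[0](ratr_int K 0) conj_ratr ratr_int.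
by move=> x y /cjE ax /cjE ay; apply/cjE; rewrite conjD conjN; apply: aB.
Qed.

Lemma cj_lat e0 e1 : cj (lat e0 e1) = lat (conj e0) (conj e1).
Proof.
rewrite eqEsubset; split=> [_ [_ [m [n ->]] <-]|_ [m [n ->]]].
  by exists m, n; rewrite conjD !conjM !conj_int.
by apply/cjE; exists m, n; rewrite conjD !conjM !conj_int !conjK.
Qed.

Lemma cj_imul a b : zsub a -> zsub b -> cj (ideal_mul a b) = ideal_mul (cj a) (cj b).
Proof.
have h (u v : set K) : zsub u -> zsub v -> ideal_mul (cj u) (cj v) `<=` cj (ideal_mul u v).
  move=> hu hv; apply: imul_sub => [|x y /cjE ux /cjE vy].
    by apply: cj_zsub; apply: imul_zsub.
  by apply/cjE; rewrite conjM; apply: imul_mem.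
move=> ha hb; rewrite eqEsubset; split; last exact: h.
move=> x /cjE abx; rewrite -[x]conjK; apply/cjE; apply: h; try exact: cj_zsub.
by rewrite !cjK.
Qed.

End Orders.

(** * Sublattices, indices and norm forms *)

(** The generator is the least positive element, which exists because of [d]; division with
    remainder does the rest. *)
Lemma int_subgroup (T : set int) (d : int) : T 0 -> (forall x y, T x -> T y -> T (x - y)) ->
  d != 0 -> T d -> exists r : nat, [/\ (0 < r)%N, T r%:Z &
    forall x, T x -> exists k : int, x = k * r%:Z].
Proof.
move=> T0 TB d0 Td.
have TN x : T x -> T (- x) by move=> Tx; rewrite -sub0r; apply: TB.
have TD x y : T x -> T y -> T (x + y).
  by move=> Tx Ty; rewrite -[y]opprK; apply: TB => //; apply: TN.
have TM x (k : int) : T x -> T (k * x).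
  move=> Tx; have TMn (n : nat) : T (n%:Z * x).
    elim: n => [|n IH]; first by rewrite mul0r.
    by rewrite intS mulrDl mul1r; apply: TD.
  by case: k => n; rewrite ?NegzE ?mulNr; [|apply: TN]; apply: TMn.
have ex : exists n : nat, (0 < n)%N && `[< T n%:Z >].
  exists `|d|%N; rewrite absz_gt0 d0 /=; apply/asboolP.
  have [->|->] : `|d|%N%:Z = d \/ `|d|%N%:Z = - d by lia.
    by [].
  exact: TN.
have [r /andP[r0 /asboolP Tr] rmin] := ex_minnP ex; exists r; split=> // x Tx.
exists (x %/ r)%Z; have hx := divz_eq x r.
have rn0 : r%:Z != 0 by rewrite eqz_nat -lt0n.
have m0 := modz_ge0 x rn0; have mr : (x %% r < r)%Z by rewrite ltz_pmod.
have Tm : T (x %% r)%Z.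
  have -> : (x %% r)%Z = x - (x %/ r)%Z * r.
    by apply/esym/eqP; rewrite subr_eq [X in _ == X]addrC -divz_eq.
  by apply: TB => //; apply: TM.
have [m0'|/eqP m0'] := eqVneq (x %% r)%Z 0; first by rewrite {1}hx m0' addr0.
have : (r <= `|(x %% r)%Z|)%N.
  apply: rmin; rewrite absz_gt0; apply/andP; split; first exact/eqP.
  by rewrite gez0_abs //; apply/asboolP.
by move: m0 mr; move: (x %% r)%Z => t; lia.
Qed.

(** Coprimality is kept as a Bezout relation because its coefficients are later used to build
    elements explicitly. *)
Lemma primitive_triple (a b c : int) : (a, b, c) != (0, 0, 0) ->
  exists k a' b' c' u v w : int, [/\ 0 < k, a = k * a', b = k * b', c = k * c' &
    u * a' + v * b' + w * c' = 1].
Proof.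
move=> abc; have [u0 [v0 hg1]] := Bezoutz a b.
have [u1 [v1 hg2]] := Bezoutz (gcdz a b) c.
set h := gcdz a b in hg1 hg2; set k := gcdz h c in hg2.
have [a' ha'] : exists a' : int, a = a' * k.
  by apply/dvdzP; apply: dvdz_trans (dvdz_gcdl _ _) (dvdz_gcdl _ _).
have [b' hb'] : exists b' : int, b = b' * k.
  by apply/dvdzP; apply: dvdz_trans (dvdz_gcdl _ _) (dvdz_gcdr _ _).
have [c' hc'] : exists c' : int, c = c' * k by apply/dvdzP; apply: dvdz_gcdr.
have k0 : k != 0 by apply: contraNneq abc => k0; rewrite ha' hb' hc' k0 !mulr0.
exists k, a', b', c', (u1 * u0), (u1 * v0), v1; split; rewrite ?[k * _]mulrC //.
  by rewrite lt_neqAle eq_sym k0 /=.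
by apply: (mulIf k0); rewrite mul1r -[RHS]hg2 -hg1 ha' hb' hc'; ring.
Qed.

Section Norms.
Variables (K : comUnitRingType) (D : int) (C : quad_coord K D).
Hypothesis Dfund : fundamental D.
Local Notation re := (re C).
Local Notation im := (im C).
Local Notation mkq := (mkq C).
Local Notation nrm := (qnorm C).
Local Notation conj := (conj C).
Local Notation areaC := (area C).
Local Notation om := (om C).
Local Notation cj := (cj C).
Implicit Types (x y z : K) (a b S : set K).

Lemma lattice_mem a x : is_lattice a -> exists2 m : int, 0 < m & a (m%:~R * x).
Proof.
move=> /(is_lattice_E C)[e0 [e1 [a0 ->]]].
pose r := areaC x e1 / areaC e0 e1; pose s := areaC e0 x / areaC e0 e1.
have hx : x = ratr r * e0 + ratr s * e1.
  by apply: (@eq_coord _ _ C); move: a0; rewrite /r /s /area !cE => a0; field.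
have [d d0 hd] := common_den [:: r; s]; exists d => //.
have /intrP[m hm] : d%:~R * r \is a Num.int by apply: hd; rewrite inE eqxx.
have /intrP[n hn] : d%:~R * s \is a Num.int by apply: hd; rewrite !inE eqxx orbT.
by exists m, n; rewrite hx; apply: (@eq_coord _ _ C); rewrite !cE -?hm -?hn; ring.
Qed.

Lemma lattice_bound a b : is_lattice a -> is_lattice b ->
  exists2 m : int, 0 < m & forall x, a x -> b (m%:~R * x).
Proof.
move=> la lb; have bz := lattice_zsub C lb.
have [e0 [e1 [a0 ->]]] := (is_lattice_E C a).1 la.
have [m m0 hm] := lattice_mem e0 lb; have [n n0 hn] := lattice_mem e1 lb.
exists (m * n); first by rewrite mulr_gt0.
move=> _ [p [q ->]].
have -> : (m * n)%:~R * (p%:~R * e0 + q%:~R * e1) =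
  (p * n)%:~R * (m%:~R * e0) + (q * m)%:~R * (n%:~R * e1) by rewrite !intrM; ring.
by apply: zsubD => //; apply: zsubMz.
Qed.

(** Hermite normal form: [p] generates the multiples of [f0] in [S], and [r] generates the
    [f1]-coordinates occurring in [S]. *)
Lemma sublattice S (f0 f1 : K) (d : int) : zsub S -> S `<=` lat f0 f1 ->
  d != 0 -> S (d%:~R * f0) -> S (d%:~R * f1) ->
  exists (p r : nat) (q : int), [/\ (0 < p)%N, (0 < r)%N &
    S = lat (p%:R * f0) (q%:~R * f0 + r%:R * f1)].
Proof.
move=> Sz SL d0 S0 S1.
have [||p [p0 Sp hp]] := @int_subgroup [set m | S (m%:~R * f0)] d _ _ d0 S0.
- by rewrite /= mul0r; case: Sz.
- by move=> x y hx hy /=; rewrite rmorphB mulrBl; apply: Sz.2.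
have [|||r [r0 [q Sr] hr]] := @int_subgroup [set n | exists m : int, S (m%:~R * f0 + n%:~R * f1)] d _ _ d0.
- by exists 0; rewrite !mul0r addr0; case: Sz.
- move=> x y [m hx] [n hy]; exists (m - n); have := Sz.2 _ _ hx hy.
  by congr S; rewrite !rmorphB /=; ring.
- by exists 0; rewrite mul0r add0r.
exists p, r, q; split=> //; rewrite eqEsubset; split=> [x Sx|]; last exact: lat_sub.
have [m [n hx]] := SL _ Sx.
have [k hk] : exists k : int, n = k * r by apply: hr; exists m; rewrite -hx.
have [j hj] : exists j : int, m - k * q = j * p.
  apply: hp; rewrite /=; have := Sz.2 _ _ Sx (zsubMz k Sz Sr); congr S.
  by rewrite hx hk !rmorphB !intrM /=; ring.
exists j, k; rewrite hx hk (_ : m = j * p + k * q); last by rewrite -hj; ring.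
by rewrite intrD !intrM /= -!pmulrn; ring.
Qed.

Lemma coset_eq a x y : zsub a ->
  ([set x + z | z in a] = [set y + z | z in a]) <-> a (x - y).
Proof.
move=> az; split=> [h|axy].
  have [z za <-] : [set y + z | z in a] x by rewrite -h; exists 0; [case: az | rewrite addr0].
  by rewrite addrAC subrr add0r.
rewrite eqEsubset; split=> [_ [z za <-]|_ [z za <-]].
  by exists (x - y + z); [apply: zsubD | rewrite addrA addrCA subrr addr0].
exists (z - (x - y)); first exact: az.2.
by ring.
Qed.

Lemma index_lat (f0 f1 : K) (p r : nat) (q : int) : areaC f0 f1 != 0 ->
  (0 < p)%N -> (0 < r)%N ->
  ideal_index (lat f0 f1) (lat (p%:R * f0) (q%:~R * f0 + r%:R * f1)) = (p * r)%N.
Proof.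
move=> a0 p0 r0; set a := lat (p%:R * f0) _; have az : zsub a by apply: lat_zsub.
(* Coset representatives are [i0 * f0 + i1 * f1] with [i0 < p] and [i1 < r], numbered by
   [i = i1 * p + i0]. *)
pose g (i : nat) : set K := [set (i %% p)%N%:R * f0 + (i %/ p)%N%:R * f1 + y | y in a].
have gI : [set [set x + y | y in a] | x in lat f0 f1] = g @` `I_(p * r).
  rewrite eqEsubset; split=> [_ [_ [m [n ->]] <-]|_ [i _ <-]]; last first.
    by exists ((i %% p)%N%:R * f0 + (i %/ p)%N%:R * f1) => //; exists (i %% p)%N%:Z, (i %/ p)%N%:Z.
  pose k := (n %/ r)%Z; pose j := `|(n %% r)%Z|%N.
  have rn0 : r%:Z != 0 by rewrite eqz_nat -lt0n.
  have pn0 : p%:Z != 0 by rewrite eqz_nat -lt0n.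
  have hn : n = k * r + j by rewrite gez0_abs ?modz_ge0 // -divz_eq.
  have jr : (j < r)%N by rewrite -ltz_nat gez0_abs ?modz_ge0 // ltz_pmod.
  pose l := ((m - k * q) %/ p)%Z; pose i := `|((m - k * q) %% p)%Z|%N.
  have hm : m - k * q = l * p + i by rewrite gez0_abs ?modz_ge0 // -divz_eq.
  have ip : (i < p)%N by rewrite -ltz_nat gez0_abs ?modz_ge0 // ltz_pmod.
  exists (j * p + i)%N.
    by rewrite /=; apply: (@leq_trans (j * p + p)); rewrite ?ltn_add2l // -mulSnr mulnC leq_mul2l jr orbT.
  rewrite /g modnMDl divnMDl // modn_small // divn_small // addn0.
  apply/coset_eq => //; exists (- l), (- k).
  have -> : m = l * p + i + k * q by rewrite -hm; ring.
  by rewrite hn !(intrD, intrM, rmorphN) /= -!pmulrn; ring.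
have ginj : {in `I_(p * r) &, injective g}.
  move=> i j; rewrite !inE /= => hi hj /coset_eq -/(_ az)[m [n h]].
  have h' : ((i %% p)%N%:Z - (j %% p)%N%:Z)%:~R * f0 + ((i %/ p)%N%:Z - (j %/ p)%N%:Z)%:~R * f1
     = (m * p + n * q)%:~R * f0 + (n * r)%:~R * f1.
    move/eqP: h; rewrite -subr_eq0 => /eqP h; apply/eqP; rewrite -subr_eq0.
    by apply/eqP; rewrite -[RHS]h !(intrD, intrM, rmorphN) /= -!pmulrn; ring.
  have [h1 h2] := lat_inj a0 h'.
  have ir : (i %/ p < r)%N by rewrite ltn_divLR // mulnC.
  have jr : (j %/ p < r)%N by rewrite ltn_divLR // mulnC.
  have n0 : n = 0 by nia.
  have ip := ltn_pmod i p0; have jp := ltn_pmod j p0.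
  have m0 : m = 0 by move: h1; rewrite n0; nia.
  by rewrite (divn_eq i p) (divn_eq j p); move: h1 h2; rewrite m0 n0; lia.
have card : ([set [set x + y | y in a] | x in lat f0 f1] #= `I_(p * r))%card.
  by rewrite gI; apply: inj_card_eq.
apply: xget_unique => // y hy; apply/esym/card_eq_II.
by apply: card_eq_trans hy; rewrite card_eq_sym.
Qed.

Lemma imul_lat (e0 e1 f0 f1 : K) S : zsub S ->
  S (e0 * f0) -> S (e0 * f1) -> S (e1 * f0) -> S (e1 * f1) ->
  ideal_mul (lat e0 e1) (lat f0 f1) `<=` S.
Proof.
move=> Sz h00 h01 h10 h11; apply: imul_sub => // _ _ [m [n ->]] [p [q ->]].
have -> : (m%:~R * e0 + n%:~R * e1) * (p%:~R * f0 + q%:~R * f1) =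
   ((m * p)%:~R * (e0 * f0) + (m * q)%:~R * (e0 * f1)) +
   ((n * p)%:~R * (e1 * f0) + (n * q)%:~R * (e1 * f1)) by rewrite !intrM; ring.
by do 2!apply: zsubD => //; apply: zsubMz.
Qed.

Lemma lattice_imul a b : is_lattice a -> is_lattice b -> is_lattice (ideal_mul a b).
Proof.
move=> la lb; have [lm _ mM] := maxorder_is_order C Dfund.
have az := lattice_zsub C la.
have abz : zsub (ideal_mul a b) by apply: imul_zsub.
have [m m0 hm] := lattice_bound la lm; have [n n0 hn] := lattice_bound lb lm.
have [i i0 hi] := lattice_mem 1 la; have [j j0 hj] := lattice_mem 1 lb.
have [k k0 hk] := lattice_mem om lb.
have mn0 : (m * n)%:~R != 0 :> rat by rewrite intr_eq0 gt_eqF // mulr_gt0.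
(* Scaling by [m * n] moves the product into the maximal order, which makes a Hermite basis
   available. The factor [i * j * k] comes from i in a, j in b and k om in b: the product contains
   both ijk and ijk om. *)
have [|||||p [r [q [p0 r0 hS]]]] := @sublattice (ideal_scale (m * n)%:~R (ideal_mul a b)) 1 om (m * n * i * j * k).
- exact: scale_zsub.
- move=> _ [y aby <-]; rewrite intrM.
  suff : ideal_mul a b `<=` [set y | lat 1 om (m%:~R * n%:~R * y)] by apply.
  have lz := lat_zsub 1 om.
  apply: imul_sub => [|s t sa tb].
    split=> /=; first by rewrite mulr0; case: lz.
    by move=> s t hs ht; rewrite mulrBr; apply: lz.2.
  by rewrite /= mulrACA; apply: mM; [exact: hm | exact: hn].
- by rewrite !mulf_neq0 // gt_eqF.
- exists ((i * j * k)%:~R * 1); last by rewrite !intrM; ring.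
  have -> : (i * j * k)%:~R * 1 = k%:~R * ((i%:~R * 1) * (j%:~R * 1)) :> K by rewrite !intrM; ring.
  by apply: zsubMz => //; apply: imul_mem.
- exists ((i * j * k)%:~R * om); last by rewrite !intrM; ring.
  have -> : (i * j * k)%:~R * om = j%:~R * ((i%:~R * 1) * (k%:~R * om)) by rewrite !intrM; ring.
  by apply: zsubMz => //; apply: imul_mem.
move: hS mn0; move: (m * n) => M hS mn0; apply/(is_lattice_E C).
have -> : ideal_mul a b = ideal_scale (ratr M%:~R^-1) (ideal_scale M%:~R (ideal_mul a b)).
  rewrite scaleA (_ : _ * _ = 1) ?scale1 //.
  by apply: (@eq_coord _ _ C); rewrite !cE; field.
rewrite hS scale_lat; eexists; eexists; split; last reflexivity.
have pn : p%:R != 0 :> rat by rewrite pnatr_eq0 -lt0n.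
have rn : r%:R != 0 :> rat by rewrite pnatr_eq0 -lt0n.
set A := area _ _ _; have -> : A = (M%:~R^-1) ^+ 2 * p%:R * r%:R / 2.
  by rewrite /A /area !cE; field.
by rewrite !mulf_neq0 // ?invr_eq0 ?expf_neq0 ?invr_eq0.
Qed.

(** [g] is the content of the norm form of the basis. The form is nonzero because its discriminant
    is 4 D area^2. *)
Lemma prim_form (e0 e1 : K) : areaC e0 e1 != 0 ->
  exists (g : rat) (A B Cc u v w : int), [/\ 0 < g, nrm e0 = g * A%:~R,
    2 * re (e0 * conj e1) = g * B%:~R, nrm e1 = g * Cc%:~R &
    u * A + v * B + w * Cc = 1].
Proof.
move=> a0; set N0 := nrm e0; set T := 2 * _; set N1 := nrm e1.
have hd : T ^+ 2 - 4 * N0 * N1 = 4 * D%:~R * areaC e0 e1 ^+ 2.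
  by rewrite /T /N0 /N1 /qnorm /area !cE; ring.
have [d d0 hdd] := common_den [:: N0; T; N1].
have dn : d%:~R != 0 :> rat by rewrite intr_eq0 gt_eqF.
have /intrP[a ha] : d%:~R * N0 \is a Num.int by apply: hdd; rewrite !inE eqxx.
have /intrP[b hb] : d%:~R * T \is a Num.int by apply: hdd; rewrite !inE eqxx orbT.
have /intrP[c hc] : d%:~R * N1 \is a Num.int by apply: hdd; rewrite !inE eqxx !orbT.
have [|kk [a' [b' [c' [u [v [w [kp ha' hb' hc' huvw]]]]]]]] := @primitive_triple a b c.
  apply: contraNneq a0 => -[a_0 b_0 _]; move: ha hb; rewrite a_0 b_0.
  move=> /eqP; rewrite mulf_eq0 (negbTE dn) /= => /eqP h0.
  move=> /eqP; rewrite mulf_eq0 (negbTE dn) /= => /eqP hT.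
  move: hd; rewrite h0 hT => /eqP; rewrite eq_sym mulr0 mul0r expr0n subr0.
  by rewrite mulf_eq0 sqrf_eq0 mulf_eq0 (negbTE (disc_neq0 Dfund)) orbF.
exists (kk%:~R / d%:~R), a', b', c', u, v, w; split=> //.
- by rewrite divr_gt0 ?ltr0z.
- by apply: (mulfI dn); rewrite ha ha' intrM; field.
- by apply: (mulfI dn); rewrite hb hb' intrM; field.
- by apply: (mulfI dn); rewrite hc hc' intrM; field.
Qed.

(** The generators of the product are g A, g th, g (B - th) and g Cc, and the Bezout relation
    extracts g from them. Stability of the lattice comes from th e0 = B e0 - A e1 and th e1 = Cc
    e0. *)
Lemma prim_mul (e0 e1 : K) (g : rat) (A B Cc u v w : int) : 0 < g ->
  nrm e0 = g * A%:~R -> 2 * re (e0 * conj e1) = g * B%:~R -> nrm e1 = g * Cc%:~R ->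
  u * A + v * B + w * Cc = 1 ->
  let th := ratr g^-1 * (e0 * conj e1) in
  ideal_mul (lat e0 e1) (cj (lat e0 e1)) = ideal_scale (ratr g) (lat 1 th) /\
  (forall x y, lat 1 th x -> lat e0 e1 y -> lat e0 e1 (x * y)).
Proof.
move=> g0 hA hB hC hu th; have gn : g != 0 by rewrite gt_eqF.
have h00 : e0 * conj e0 = ratr g * A%:~R.
  by rewrite mul_conj hA; apply: (@eq_coord _ _ C); rewrite !cE; ring.
have h11 : e1 * conj e1 = ratr g * Cc%:~R.
  by rewrite mul_conj hC; apply: (@eq_coord _ _ C); rewrite !cE; ring.
have h01 : e0 * conj e1 = ratr g * th.
  by apply: (@eq_coord _ _ C); rewrite /th !cE; field.
have h10 : e1 * conj e0 = ratr g * (B%:~R - th).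
  have hB' : ratr g * B%:~R = e0 * conj e1 + e1 * conj e0.
    by apply: (@eq_coord _ _ C); move: hB; rewrite !cE; lra.
  by rewrite mulrBr hB' -h01; ring.
have latz := lat_zsub 1 th; split.
  rewrite cj_lat eqEsubset; split.
    apply: imul_lat; first exact: scale_zsub.
    - by rewrite h00; exists A%:~R => //; exists A, 0; ring.
    - by rewrite h01; exists th => //; exists 0, 1; ring.
    - by rewrite h10; exists (B%:~R - th) => //; exists B, (-1); ring.
    - by rewrite h11; exists Cc%:~R => //; exists Cc, 0; ring.
  have iz : zsub (ideal_mul (lat e0 e1) (lat (conj e0) (conj e1))).
    by apply: imul_zsub; apply: lat_zsub.
  have l0 := lat_l e0 e1; have l1 := lat_r e0 e1.
  have c0 := lat_l (conj e0) (conj e1); have c1 := lat_r (conj e0) (conj e1).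
  rewrite scale_lat; apply: lat_sub => //; last by rewrite -h01; apply: imul_mem.
  have -> : ratr g * 1 = (u%:~R * (e0 * conj e0) + v%:~R * (e0 * conj e1 + e1 * conj e0)) +
     w%:~R * (e1 * conj e1).
    rewrite h00 h11 h01 h10.
    transitivity ((ratr g : K) * (u * A + v * B + w * Cc)%:~R); first by rewrite hu.
    by rewrite !intrD !intrM; ring.
  apply: zsubD => //; last by apply: zsubMz => //; apply: imul_mem.
  apply: zsubD => //; first by apply: zsubMz => //; apply: imul_mem.
  by apply: zsubMz => //; apply: zsubD => //; apply: imul_mem.
have t1 : th * e1 = Cc%:~R * e0.
  transitivity (ratr g^-1 * (e1 * conj e1) * e0); first by rewrite /th; ring.
  by rewrite h11; apply: (@eq_coord _ _ C); rewrite !cE; field.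
have t0 : th * e0 = B%:~R * e0 - A%:~R * e1.
  have ht : th = B%:~R - ratr g^-1 * (e1 * conj e0).
    by rewrite h10; apply: (@eq_coord _ _ C); rewrite !cE; field.
  transitivity (B%:~R * e0 - ratr g^-1 * (e0 * conj e0) * e1); first by rewrite {1}ht; ring.
  by rewrite h00; congr (_ - _); apply: (@eq_coord _ _ C); rewrite !cE; field.
move=> _ _ [m [n ->]] [p [q ->]].
exists (m * p + n * p * B + n * q * Cc), (m * q - n * p * A).
rewrite !(intrD, rmorphB, intrM) /=.
transitivity (m%:~R * p%:~R * e0 + m%:~R * q%:~R * e1 + n%:~R * p%:~R * (th * e0)
   + n%:~R * q%:~R * (th * e1)); first by ring.
by rewrite t0 t1; ring.
Qed.

End Norms.

(** * Invertible ideals and the ideal norm *)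

Section Invertible.
Variables (K : comUnitRingType) (D : int) (C : quad_coord K D).
Hypothesis Dfund : fundamental D.
Variable c : nat.
Hypothesis c_gt0 : (0 < c)%N.
Local Notation re := (re C).
Local Notation im := (im C).
Local Notation mkq := (mkq C).
Local Notation nrm := (qnorm C).
Local Notation conj := (conj C).
Local Notation areaC := (area C).
Local Notation om := (om C).
Local Notation cj := (cj C).
Local Notation O := (@order_c K c).
Local Notation eqC := (@eq_coord _ _ C).
Implicit Types (x y z : K) (a b S : set K).

Lemma c_neq0 : c%:R != 0 :> rat.
Proof. by rewrite pnatr_eq0 -lt0n. Qed.

Lemma order_mem x : O x <-> (exists k : int, 2 * im x = c%:R * k%:~R) /\
  re x - D%:~R * im x \is a Num.int.
Proof. by rewrite (order_c_E C Dfund) mem_Oc. Qed.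

Lemma area_order : areaC 1 (c%:R * om) = c%:R / 2.
Proof. by rewrite /area !cE; field. Qed.

Lemma order_lattice : is_lattice O.
Proof.
apply/(is_lattice_E C); exists 1, (c%:R * om); rewrite area_order (order_c_E C Dfund).
by rewrite mulf_neq0 ?c_neq0.
Qed.

Lemma order_zsub : zsub O.
Proof. exact: lattice_zsub C _ order_lattice. Qed.

Lemma order1 : O 1.
Proof. by rewrite (order_c_E C Dfund); apply: lat_l. Qed.

Lemma orderM x y : O x -> O y -> O (x * y).
Proof.
have [k hk] := om_sq C Dfund; rewrite (order_c_E C Dfund).
move=> [m [n ->]] [p [q ->]].
exists (m * p - n * q * k * c%:Z * c%:Z), (m * q + n * p + n * q * D * c%:Z).
rewrite !(intrD, rmorphN, intrM) /= -!pmulrn.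
transitivity (m%:~R * p%:~R + (m%:~R * q%:~R + n%:~R * p%:~R) * (c%:R * om) +
  n%:~R * q%:~R * c%:R * c%:R * (om * om)); first by ring.
by rewrite hk; ring.
Qed.

Lemma cj_order : cj O = O.
Proof.
suff h : cj O `<=` O.
  by rewrite eqEsubset; split=> // x Ox; apply/cjE; apply: h; apply/cjE; rewrite conjK.
move=> x /cjE /order_mem; rewrite !cE => -[[k hk] /intrP[m hm]]; apply/order_mem; split.
  by exists (- k); rewrite rmorphN; lra.
apply/intrP; exists (m + D * c%:Z * k); rewrite intrD !intrM /= -pmulrn -hm.
by rewrite -mulrA -hk; ring.
Qed.

Lemma imul_order a : frac_ideal O a -> ideal_mul O a = a.
Proof.
move=> [la Oa]; rewrite eqEsubset; split.
  by apply: imul_sub => //; apply: lattice_zsub C _ la.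
by move=> x ax; rewrite -[x]mul1r; apply: imul_mem => //; exact: order1.
Qed.

Lemma frac_order : frac_ideal O O.
Proof. by split; [exact: order_lattice | exact: orderM]. Qed.

(** This relation replaces the quotient of indices in [ideal_norm]: it is visibly multiplicative and
    exhibits conj(a) / g as the inverse of a. Positivity makes [g] unique. *)
Definition has_norm a (g : rat) :=
  [/\ 0 < g, frac_ideal O a & ideal_mul a (cj a) = ideal_scale (ratr g) O].

Lemma has_norm_zsub a g : has_norm a g -> zsub a.
Proof. by case=> _ [la _] _; apply: lattice_zsub C _ la. Qed.

(** Both inclusions of [O = lat 1 th] are multiplier arguments. [O] stabilises a conj(a) = g (Z + Z
    th), which contains g, so [O] lies in Z + Z th; conversely Z + Z th stabilises a, hence also a J
    = [O], which contains 1. *)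
Lemma invertible_data (e0 e1 : K) : areaC e0 e1 != 0 -> invertible O (lat e0 e1) ->
  exists (g : rat) (A B Cc u v w : int), [/\ has_norm (lat e0 e1) g,
    nrm e0 = g * A%:~R, 2 * re (e0 * conj e1) = g * B%:~R, nrm e1 = g * Cc%:~R &
    u * A + v * B + w * Cc = 1 /\ O = lat 1 (ratr g^-1 * (e0 * conj e1))].
Proof.
move=> a0 [fa [J [fJ hJ]]]; have [g [A [B [Cc [u [v [w [g0 hA hB hC hu]]]]]]]] := prim_form Dfund a0.
have [h1 h2] := prim_mul g0 hA hB hC hu.
set a := lat e0 e1 in fa hJ h1 h2 *; set th := ratr _ * _ in h1 h2 *.
have gn : g != 0 by rewrite gt_eqF.
have az : zsub a by apply: lat_zsub.
have hO : O = lat 1 th.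
  rewrite eqEsubset; split=> x hx.
    have : ideal_mul a (cj a) (x * (ratr g * 1)).
      have : ideal_mul a (cj a) (ratr g * 1) by rewrite h1; exists 1 => //; apply: lat_l.
      suff : ideal_mul a (cj a) `<=` [set y | ideal_mul a (cj a) (x * y)] by apply.
      have iz : zsub (ideal_mul a (cj a)) by apply: imul_zsub.
      apply: imul_sub => [|s t hs ht].
        split=> /=; first by rewrite mulr0; case: iz.
        by move=> s t hs ht; rewrite mulrBr; apply: iz.2.
      by rewrite /= mulrA; apply: imul_mem => //; apply: fa.2.
    rewrite h1 => -[y hy]; rewrite mulr1 mulrC => h.
    suff -> : x = y by [].
    transitivity (ratr g^-1 * (x * ratr g)); first by apply: eqC; rewrite !cE; field.
    by rewrite -h; apply: eqC; rewrite !cE; field.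
  have : O (x * 1).
    have : ideal_mul a J 1 by rewrite hJ; exact: order1.
    suff : ideal_mul a J `<=` [set y | O (x * y)] by apply.
    have iz := order_zsub.
    apply: imul_sub => [|s t hs ht].
      split=> /=; first by rewrite mulr0; case: iz.
      by move=> s t hs ht; rewrite mulrBr; apply: iz.2.
    by rewrite /= mulrA -hJ; apply: imul_mem => //; apply: h2.
  by rewrite mulr1.
exists g, A, B, Cc, u, v, w; split=> //.
by split=> //; rewrite h1 hO.
Qed.

(** A rational element of [O] is an integer, so each of two norms is a positive integral multiple of
    the other. *)
Lemma has_norm_uniq a g h : has_norm a g -> has_norm a h -> g = h.
Proof.
suff le (u v : rat) : 0 < u -> 0 < v -> ideal_scale (ratr u) O = ideal_scale (ratr v) O ->
    exists2 m : nat, (0 < m)%N & u = m%:R * v.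
  move=> [g0 _ hg] [h0 _]; rewrite hg => e.
  have [m m0 hm] := le _ _ g0 h0 e; have [n n0 hn] := le _ _ h0 g0 (esym e).
  have : m%:R * n%:R = 1 :> rat.
    have hne : h != 0 by rewrite gt_eqF.
    have e2 : h = n%:R * (m%:R * h) by rewrite -hm.
    by apply: (mulIf hne); rewrite mul1r [RHS]e2; ring.
  rewrite -natrM => /eqP; rewrite pnatr_eq1 muln_eq1 => /andP[/eqP m1 _].
  by rewrite hm m1 mul1r.
move=> u0 v0 e.
have : ideal_scale (ratr v) O (ratr u) by rewrite -e; exists 1; [exact: order1 | rewrite mulr1].
move=> [y /order_mem[_ hr] hy].
have hi : im y = 0.
  have := congr1 im hy; rewrite !cE mul0r addr0 => /eqP.
  by rewrite mulf_eq0 (gt_eqF v0) /= => /eqP.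
have hre := congr1 re hy; rewrite !cE hi !(mulr0, mul0r) addr0 in hre.
move: hr; rewrite hi mulr0 subr0 => /intrP[m hm].
have mp : 0 < m by rewrite -(ltr0z rat) -hm -(pmulr_rgt0 _ v0) hre.
exists `|m|%N; first by rewrite absz_gt0 gt_eqF.
by rewrite natr_absz gtr0_norm // -hm -hre mulrC.
Qed.

Lemma has_norm_order : has_norm O 1.
Proof.
split=> //; first exact: frac_order.
rewrite cj_order imul_order; last exact: frac_order.
rewrite (_ : ratr 1 = 1) ?scale1 //.
by apply: eqC; rewrite !cE.
Qed.

Lemma scaleN1_order : ideal_scale (-1) O = O.
Proof.
have h x : O x -> O (- x) by apply: zsubN; exact: order_zsub.
rewrite eqEsubset; split=> [_ [y /h Oy <-]|x /h Ox]; first by rewrite mulN1r.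
by exists (- x) => //; rewrite mulN1r opprK.
Qed.

Lemma scale_frac x a : nrm x != 0 -> frac_ideal O a -> frac_ideal O (ideal_scale x a).
Proof.
move=> nx [/(is_lattice_E C)[e0 [e1 [a0 ->]]] Oa]; split.
  rewrite scale_lat; apply/(is_lattice_E C); exists (x * e0), (x * e1); split=> //.
  have -> : areaC (x * e0) (x * e1) = nrm x * areaC e0 e1.
    by rewrite /area /qnorm !cE; ring.
  by rewrite mulf_neq0.
by move=> y _ Oy [z az <-]; exists (y * z); [exact: Oa | ring].
Qed.

Lemma has_norm_scale x a g : nrm x != 0 -> has_norm a g ->
  has_norm (ideal_scale x a) (`|nrm x| * g).
Proof.
move=> nx [g0 fa ha]; split; first by rewrite mulr_gt0 // normr_gt0.
  exact: scale_frac.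
have -> : cj (ideal_scale x a) = ideal_scale (conj x) (cj a).
  rewrite eqEsubset; split=> [_ [_ [y ay <-] <-]|_ [_ [y ay <-] <-]].
    by exists (conj y); [exists y | rewrite conjM].
  by exists (x * y); [exists y | rewrite conjM].
rewrite scale_imul scale_imulr scaleA mul_conj ha scaleA.
have [n0|n0] := leP 0 (nrm x).
  by rewrite ger0_norm //; congr ideal_scale; apply: eqC; rewrite !cE; ring.
(* The norm of an ideal is positive; a negative norm of [x] is corrected by the unit -1 of [O]. *)
rewrite -[in LHS]scaleN1_order scaleA ltr0_norm //.
by congr ideal_scale; apply: eqC; rewrite !cE; ring.
Qed.

Lemma has_norm_cj a g : has_norm a g -> has_norm (cj a) g.
Proof.
move=> [g0 [/(is_lattice_E C)[e0 [e1 [a0 ha]]] Oa] hg]; split=> //; last by rewrite cjK imulC.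
split.
  rewrite ha cj_lat; apply/(is_lattice_E C); exists (conj e0), (conj e1); split=> //.
  by rewrite (_ : area _ _ _ = - areaC e0 e1) ?oppr_eq0 // /area !cE; ring.
move=> x y Ox /cjE ay; apply/cjE; rewrite conjM; apply: Oa => //.
by rewrite -cj_order; apply/cjE; rewrite conjK.
Qed.

Lemma has_norm_imul a b g h : has_norm a g -> has_norm b h ->
  has_norm (ideal_mul a b) (g * h).
Proof.
move=> [g0 fa hg] [h0 fb hh].
have az := lattice_zsub C fa.1; have bz := lattice_zsub C fb.1.
have caz := cj_zsub C az; have cbz := cj_zsub C bz.
split; first by rewrite mulr_gt0.
  split; first exact: lattice_imul C Dfund _ _ fa.1 fb.1.
  move=> x y Ox; have iz : zsub (ideal_mul a b) by apply: imul_zsub.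
  suff : ideal_mul a b `<=` [set y | ideal_mul a b (x * y)] by apply.
  apply: imul_sub => [|s t hs ht].
    split=> /=; first by rewrite mulr0; case: iz.
    by move=> s t hs ht; rewrite mulrBr; apply: iz.2.
  by rewrite /= mulrA; apply: imul_mem => //; apply: fa.2.
rewrite (cj_imul C az bz) (imulC (cj a)) (imulA (imul_zsub _ az) cbz caz).
rewrite -(imulA az bz cbz) hh scale_imulr scale_imul (imulC a) imul_order //.
rewrite hg scaleA; congr ideal_scale; apply: eqC; rewrite !cE; ring.
Qed.

Lemma invertible_has_norm a : invertible O a <-> exists g, has_norm a g.
Proof.
split=> [inv|[g [g0 fa hg]]].
  have [[/(is_lattice_E C)[e0 [e1 [a0 ha]]] _] _] := inv.
  move: inv; rewrite ha => /(invertible_data a0)[g [A [B [Cc [u [v [w [hg _ _ _ _]]]]]]]].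
  by exists g.
split=> //; exists (ideal_scale (ratr g^-1) (cj a)); split.
  apply: scale_frac; last by case: (@has_norm_cj a g).
  by rewrite /qnorm !cE expr0n mulr0 subr0 expf_neq0 // invr_eq0 gt_eqF.
rewrite scale_imulr hg scaleA (_ : _ * _ = 1) ?scale1 //.
have gn : g != 0 by rewrite gt_eqF.
by apply: eqC; rewrite !cE; field.
Qed.

Lemma ideal_inv_E a g : has_norm a g -> ideal_inv O a = ideal_scale (ratr g^-1) (cj a).
Proof.
move=> hag; have [g0 fa hg] := hag; have gn : g != 0 by rewrite gt_eqF.
have inv : is_inverse O a (ideal_scale (ratr g^-1) (cj a)).
  split.
    apply: scale_frac; last by case: (@has_norm_cj a g).
    by rewrite /qnorm !cE expr0n mulr0 subr0 expf_neq0 // invr_eq0.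
  rewrite scale_imulr hg scaleA (_ : _ * _ = 1) ?scale1 //.
  by apply: eqC; rewrite !cE; field.
apply: xget_unique => // b [fb hb]; case: inv => fi hi.
have z := lattice_zsub C; have az := z _ fa.1; have bz := z _ fb.1; have iz := z _ fi.1.
by rewrite -[LHS](imul_order fb) -hi (imulC a) -(imulA iz az bz) hb imulC imul_order.
Qed.

(** (1, c om) and (1, e0 conj(e1) / g) are two bases of [O], so their areas agree up to sign; the
    second has area -area(e0, e1) / g. *)
Lemma area_has_norm (e0 e1 : K) g : areaC e0 e1 != 0 -> has_norm (lat e0 e1) g ->
  areaC e0 e1 ^+ 2 = g ^+ 2 * c%:R ^+ 2 / 4.
Proof.
move=> a0 hg; have inv : invertible O (lat e0 e1) by apply/invertible_has_norm; exists g.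
have [g' [A [B [Cc [u [v [w [hg' _ _ _ [_ hO]]]]]]]]] := invertible_data a0 inv.
have g0 : 0 < g by case: hg.
rewrite -(has_norm_uniq hg hg') in hO; have gn : g != 0 by rewrite gt_eqF.
rewrite (order_c_E C Dfund) in hO.
have ao : areaC 1 (c%:R * om) != 0 by rewrite area_order mulf_neq0 ?c_neq0.
have [m [n [p [q [h1 h2 hdet]]]]] := lat_change hO ao.
have hdet' : (m%:~R * q%:~R - n%:~R * p%:~R) ^+ 2 = 1 :> rat.
  by rewrite -!intrM -rmorphB -rmorphXn hdet.
have : areaC 1 (ratr g^-1 * (e0 * conj e1)) ^+ 2 = (c%:R / 2) ^+ 2.
  transitivity ((m%:~R * q%:~R - n%:~R * p%:~R) ^+ 2 * areaC 1 (c%:R * om) ^+ 2).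
    by rewrite {1}h1 h2 /area !cE; ring.
  by rewrite hdet' mul1r area_order.
have -> : areaC 1 (ratr g^-1 * (e0 * conj e1)) = - (g^-1 * areaC e0 e1).
  by rewrite /area !cE; ring.
move=> h; transitivity (g ^+ 2 * (- (g^-1 * areaC e0 e1)) ^+ 2); first by field.
by rewrite h; field.
Qed.

(** In a Hermite basis the index is p r and the area is p r c / 2, while the area is also g c / 2 up
    to sign. *)
Lemma ideal_index_E a g : has_norm a g -> a `<=` O -> (ideal_index O a)%:R = g.
Proof.
move=> hag aO; have [g0 [la _] _] := hag; have az := lattice_zsub C la.
have [m1 m10 h1] := lattice_mem C 1 la; have [m2 m20 h2] := lattice_mem C (c%:R * om) la.
have ao : areaC 1 (c%:R * om) != 0 by rewrite area_order mulf_neq0 ?c_neq0.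
have [||||p [r [q [p0 r0 hS]]]] := @sublattice _ a 1 (c%:R * om) (m1 * m2) az.
- by rewrite -(order_c_E C Dfund).
- by rewrite mulf_neq0 ?gt_eqF.
- by rewrite intrM mulrAC mulrC; apply: zsubMz.
- by rewrite intrM -mulrA; apply: zsubMz.
rewrite {1}(order_c_E C Dfund) hS (index_lat _ ao) //.
have pn : p%:R != 0 :> rat by rewrite pnatr_eq0 -lt0n.
have rn : r%:R != 0 :> rat by rewrite pnatr_eq0 -lt0n.
have hA : areaC (p%:R * 1) (q%:~R * 1 + r%:R * (c%:R * om)) = p%:R * r%:R * c%:R / 2.
  by rewrite /area !cE; field.
have A0 : areaC (p%:R * 1) (q%:~R * 1 + r%:R * (c%:R * om)) != 0.
  by rewrite hA !mulf_neq0 ?c_neq0.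
move: hag; rewrite hS => /(area_has_norm A0); rewrite hA => h.
apply/eqP; rewrite -(@eqrXn2 _ 2) ?ler0n ?ltW // natrM; apply/eqP.
have cn := c_neq0; have c4 : c%:R ^+ 2 / 4 != 0 :> rat by rewrite mulf_neq0 ?expf_neq0.
by apply: (mulIf c4); rewrite [RHS]mulrA -h; field.
Qed.

Lemma ideal_norm_E a g : has_norm a g -> ideal_norm O a = g.
Proof.
move=> hag; apply: xget_unique => [|r [a1 [a2 [[i1 s1] [i2 s2] h12 ->]]]].
  (* With m a inside [O], the pair m a, m [O] is a witness, its indices being m^2 g and m^2. Any
     other pair gives the same quotient by multiplicativity. *)
  have [m m0 hm] := lattice_bound C (let: And3 _ fa _ := hag in fa.1) order_lattice.
  have mq : (m%:~R : rat) != 0 by rewrite intr_eq0 gt_eqF.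
  have mn : nrm m%:~R != 0 by rewrite nrm_intr expf_neq0.
  have N2 := has_norm_scale mn has_norm_order; have N1 := has_norm_scale mn hag.
  exists (ideal_scale m%:~R a), (ideal_scale m%:~R O).
  have S1 : ideal_scale m%:~R a `<=` O by move=> _ [y ay <-]; apply: hm.
  have S2 : ideal_scale m%:~R O `<=` O.
    by move=> _ [y Oy <-]; apply: zsubMz => //; exact: order_zsub.
  split.
  - by split=> //; apply/invertible_has_norm; exists (`|nrm m%:~R| * g).
  - by split=> //; apply/invertible_has_norm; exists (`|nrm m%:~R| * 1).
  - by rewrite scale_imulr imulC imul_order //; case: hag.
  rewrite (ideal_index_E N1 S1) (ideal_index_E N2 S2) nrm_intr.
  by rewrite ger0_norm ?sqr_ge0 //; field.
have [g1 n1] := (invertible_has_norm a1).1 i1; have [g2 n2] := (invertible_has_norm a2).1 i2.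
rewrite (ideal_index_E n1 s1) (ideal_index_E n2 s2).
have := has_norm_imul hag n2; rewrite h12 => /(has_norm_uniq n1) ->.
by rewrite mulfK //; case: n2 => g20 _ _; rewrite gt_eqF.
Qed.

End Invertible.

(** * Duality and the coefficients of the form attached to (a, beta) *)

Section Dual.
Variables (K : comUnitRingType) (D : int) (C : quad_coord K D).
Hypothesis Dfund : fundamental D.
Variable c : nat.
Hypothesis c_gt0 : (0 < c)%N.
Local Notation re := (re C).
Local Notation im := (im C).
Local Notation mkq := (mkq C).
Local Notation nrm := (qnorm C).
Local Notation conj := (conj C).
Local Notation areaC := (area C).
Local Notation om := (om C).
Local Notation cj := (cj C).
Local Notation O := (@order_c K c).
Local Notation has_norm := (has_norm C c).
Local Notation eqC := (@eq_coord _ _ C).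
Implicit Types (x y z : K) (a b S : set K).

Let cn : c%:R != 0 :> rat := c_neq0 c_gt0.
Let Dn : D%:~R != 0 :> rat := disc_neq0 Dfund.

(* The inverse of c sqrt(Delta): its multiples by elements of O_c have integral trace. *)
Definition codiff : K := mkq 0 (c%:R * D%:~R)^-1.

Lemma re_codiff x : re (x * codiff) = im x / c%:R.
Proof. by rewrite !cE; field; rewrite cn Dn. Qed.

(** Testing at z = 1 gives 2 im(y) / c, and at z = c om it gives re(y) + D im(y); integrality of
    both is membership in [O]. *)
Lemma order_dual y : (forall z, O z -> 2 * re (y * codiff * z) \is a Num.int) <-> O y.
Proof.
split=> [h|Oy z Oz].
  have /intrP[k hk] := h _ (order1 C Dfund c).
  have /intrP[m hm] : 2 * re (y * codiff * (c%:R * om)) \is a Num.int.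
    by apply: h; rewrite (order_c_E C Dfund); apply: lat_r.
  apply/(order_mem C Dfund c_gt0).
  have hi : 2 * im y = c%:R * k%:~R.
    by rewrite -hk mulr1 re_codiff; field.
  split; first by exists k.
  apply/intrP; exists (m - D * (c%:Z * k)); rewrite rmorphB /= !intrM -pmulrn -hi -hm.
  by rewrite mulrAC re_codiff !cE; field.
have /(order_mem C Dfund c_gt0)[[k hk] _] := orderM C Dfund Oy Oz.
apply/intrP; exists k; rewrite mulrAC re_codiff; apply: (mulfI cn); rewrite -hk; field.
by [].
Qed.

(** [order_dual] transported along a conj(a) = g O: up to the factor [codiff / g], the modules a and
    conj(a) are dual for the trace. *)
Lemma norm_dual a g x : has_norm a g ->
  a x <-> forall y, cj a y -> 2 * re (x * codiff * ratr g^-1 * y) \is a Num.int.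
Proof.
move=> hag; have [g0 fa ha] := hag; have gn : g != 0 by rewrite gt_eqF.
have az := has_norm_zsub hag; have [_ fc _] := has_norm_cj Dfund c_gt0 hag.
split=> [ax y cy|h].
  have : ideal_mul a (cj a) (x * y) by apply: imul_mem.
  rewrite ha => -[w Ow hw].
  have -> : x * codiff * ratr g^-1 * y = w * codiff * 1.
    transitivity (ratr g^-1 * (x * y) * codiff); first by ring.
    by rewrite -hw; apply: eqC; rewrite !cE; field; rewrite ?gn ?cn ?Dn.
  by apply/(order_dual w).2 => //; exact: order1 C Dfund c.
have hO y : cj a y -> O (x * y * ratr g^-1).
  move=> cy; apply/order_dual => z Oz.
  have := h (z * y) (fc.2 _ _ Oz cy); congr (2 * re _ \is a Num.int); ring.
(* Write g as a sum of products s t with s in a and t in conj(a); then x is the sum of the (x t / g)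
   s, and each x t / g lies in [O]. *)
have : ideal_mul a (cj a) (ratr g * 1) by rewrite ha; exists 1 => //; exact: order1 C Dfund c.
suff : ideal_mul a (cj a) `<=` [set w | a (x * ratr g^-1 * w)].
  move=> /[apply] /=; congr a; apply: eqC; rewrite !cE; by field.
apply: imul_sub => [|s t hs ht].
  split=> /=; first by rewrite mulr0; case: az.
  by move=> s t hs ht; rewrite mulrBr; apply: az.2.
rewrite /= (_ : _ * _ = (x * t * ratr g^-1) * s); last by ring.
by apply: fa.2 => //; exact: hO.
Qed.

Lemma cube_lat (f0 f1 : K) S : zsub S -> S (f0 ^+ 3) -> S (f0 ^+ 2 * f1) ->
  S (f0 * f1 ^+ 2) -> S (f1 ^+ 3) -> ideal_cube (lat f0 f1) `<=` S.
Proof.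
move=> Sz h0 h1 h2 h3; apply: imul_sub => // x y hx [i [j ->]].
suff : ideal_mul (lat f0 f1) (lat f0 f1) `<=` [set x | S (x * (i%:~R * f0 + j%:~R * f1))] by apply.
apply: imul_sub => [|_ _ [m [n ->]] [p [q ->]]] /=.
  split=> /=; first by rewrite mul0r; case: Sz.
  by move=> s t hs ht; rewrite mulrBl; apply: Sz.2.
have -> : (m%:~R * f0 + n%:~R * f1) * (p%:~R * f0 + q%:~R * f1) * (i%:~R * f0 + j%:~R * f1) =
  ((m * p * i)%:~R * f0 ^+ 3 + (m * p * j + m * q * i + n * p * i)%:~R * (f0 ^+ 2 * f1)) +
  ((m * q * j + n * p * j + n * q * i)%:~R * (f0 * f1 ^+ 2) + (n * q * j)%:~R * f1 ^+ 3).
  by rewrite !(intrD, intrM); ring.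
by do 2!apply: zsubD => //; apply: zsubMz.
Qed.

Lemma has_norm_cube a g : has_norm a g -> has_norm (ideal_cube a) (g ^+ 3).
Proof.
by move=> h; rewrite exprSr expr2; do 2!apply: (has_norm_imul Dfund) => //.
Qed.

Lemma cj_cube a : zsub a -> cj (ideal_cube a) = ideal_cube (cj a).
Proof. by move=> az; rewrite /ideal_cube !cj_imul //; apply: imul_zsub. Qed.

(** conj(a)^3 is generated by four cubic monomials, so duality for a^3 leaves four traces to test.
    They are x0, x1/3, x2/3 and x3. *)
Lemma mem_cubeP (e0 e1 : K) g beta : has_norm (lat e0 e1) g ->
  let t z := 2 * re (beta * codiff * ratr (g ^+ 3)^-1 * z) in
  ideal_cube (lat e0 e1) beta <->
  [/\ t (conj e0 ^+ 3) \is a Num.int, t (conj e0 ^+ 2 * conj e1) \is a Num.int,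
      t (conj e0 * conj e1 ^+ 2) \is a Num.int & t (conj e1 ^+ 3) \is a Num.int].
Proof.
move=> hg t; have [_ [_ _] _] := hg; have az : zsub (lat e0 e1) by apply: lat_zsub.
split=> [/(norm_dual _ (has_norm_cube hg))|[h0 h1 h2 h3]].
  rewrite cj_cube // cj_lat => h.
  have l0 := lat_l (conj e0) (conj e1); have l1 := lat_r (conj e0) (conj e1).
  split; apply: h; rewrite ?exprSr ?expr0 ?mul1r ?mulrA;
    do 2!apply: imul_mem => //.
apply/(norm_dual _ (has_norm_cube hg)); rewrite cj_cube // cj_lat.
suff : ideal_cube (lat (conj e0) (conj e1)) `<=` [set y | t y \is a Num.int] by [].
apply: cube_lat => //; split=> /=; first by rewrite /t mulr0 re0 mulr0 rpred0.
by move=> x y hx hy; rewrite /t mulrBr reD reN mulrDr mulrN rpredB.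
Qed.

Lemma Sset_E (b : nat) a beta : (0 < b)%N -> Sset b c (a, beta) <->
  exists g, [/\ has_norm a g, `|nrm beta| = b%:R * g ^+ 3 & ideal_cube a beta].
Proof.
move=> b0.
have inv_norm g : has_norm a g -> ideal_inv O a = ideal_scale (ratr g^-1) (cj a) /\
   has_norm (ideal_cube (ideal_inv O a)) (g^-1 ^+ 3).
  move=> hag; have [g0 _ _] := hag; have gn : g != 0 by rewrite gt_eqF.
  rewrite (ideal_inv_E Dfund c_gt0 hag); split=> //; apply: has_norm_cube.
  have n0 : nrm (ratr g^-1) = g^-1 ^+ 2 by rewrite /qnorm !cE; ring.
  have := has_norm_scale Dfund c_gt0 (x := ratr g^-1) _ (has_norm_cj Dfund c_gt0 hag).
  rewrite n0 ger0_norm ?sqr_ge0 // (_ : _ ^+ 2 * g = g^-1); last by field.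
  by apply; rewrite expf_neq0 // invr_eq0.
split=> [[inv hb hN]|[g [hag hN hb]]].
  have [g hag] := (invertible_has_norm C Dfund c_gt0 a).1 inv.
  have [hI hI3] := inv_norm _ hag; exists g; split=> //.
  have g0 : 0 < g by case: hag.
  (* If N(beta) = 0, no witness for the norm exists: it would make a multiple of beta invertible, so
     that 1 is a multiple of beta. The norm is then the default 0, which is not [b]. *)
  have [n0|n0] := eqVneq (nrm beta) 0.
    move: hN; rewrite /ideal_norm xgetPN => [/eqP|r [a1 [a2 [[i1 _] _ h12 _]]]].
      by rewrite eq_sym pnatr_eq0 (gtn_eqF b0).
    have [_ [J [_ hJ]]] := i1; have : ideal_mul a1 J 1 by rewrite hJ; exact: order1 C Dfund c.
    rewrite -h12 !scale_imul => -[y _ /(congr1 nrm)/eqP].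
    by rewrite nrmM n0 mul0r /qnorm !cE expr0n mulr0 subr0 expr1n eq_sym oner_eq0.
  move: hN; rewrite (ideal_norm_E Dfund c_gt0 (has_norm_scale Dfund c_gt0 n0 hI3)) => <-.
  by field; rewrite gt_eqF.
have [hI hI3] := inv_norm _ hag; have g0 : 0 < g by case: hag.
have n0 : nrm beta != 0.
  by rewrite -normr_eq0 hN mulf_neq0 ?pnatr_eq0 ?gt_eqF // exprn_gt0.
split=> //; first by apply/(invertible_has_norm C Dfund c_gt0); exists g.
rewrite (ideal_norm_E Dfund c_gt0 (has_norm_scale Dfund c_gt0 n0 hI3)) hN.
by field; rewrite gt_eqF.
Qed.

End Dual.

Lemma cubic_ext (p0 p1 p2 p3 q0 q1 q2 q3 : rat) :
  (forall u v : rat, p0 * u ^+ 3 + p1 * u ^+ 2 * v + p2 * u * v ^+ 2 + p3 * v ^+ 3 =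
     q0 * u ^+ 3 + q1 * u ^+ 2 * v + q2 * u * v ^+ 2 + q3 * v ^+ 3) ->
  [/\ p0 = q0, p1 = q1, p2 = q2 & p3 = q3].
Proof.
move=> h; have := h 1 0; have := h 0 1; have := h 1 1; have := h 1 (-1).
by move=> h1 h2 h3 h4; split; lra.
Qed.

Section Data.
Variables (k : quad_alg) (D : int) (C : quad_coord k D).
Hypothesis Dfund : fundamental D.
Hypothesis conjE : forall x : k, qconj x = conj C x.
Hypothesis sqrtE : qsqrtD k = mkq C 0 1.
Local Notation re := (re C).
Local Notation im := (im C).
Local Notation mkq := (mkq C).
Local Notation nrm := (qnorm C).
Local Notation conj := (conj C).
Local Notation areaC := (area C).
Local Notation eqC := (@eq_coord _ _ C).
Implicit Types (a : set k) (beta : k) (e : 'I_2 -> k) (x : cubic_form).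

(* beta / (c sqrt(Delta) N(a)^3), when g = N(a). *)
Definition kap (c : nat) (g : rat) beta := beta * codiff C c * ratr (g ^+ 3)^-1.

(** The triple [rep] rewritten as equations. [s] is the common sign of N(beta) and of the area of
    the basis, so the orientation condition is absorbed in [fd_area] and [fd_nrm]. *)
Record form_data (b c : nat) a beta e x (g s : rat) : Prop := FormData {
  fd_b : (0 < b)%N;
  fd_c : (0 < c)%N;
  fd_area : areaC (e 0) (e 1) = s * g * c%:R / 2;
  fd_lat : a = lat (e 0) (e 1);
  fd_norm : has_norm C c a g;
  fd_s : s ^+ 2 = 1;
  fd_nrm : nrm beta = s * b%:R * g ^+ 3;
  fd_cube : ideal_cube a beta;
  fd_0 : cf0 x = 2 * re (kap c g beta * conj (e 0) ^+ 3);
  fd_1 : cf1 x = 3 * (2 * re (kap c g beta * (conj (e 0) ^+ 2 * conj (e 1))));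
  fd_2 : cf2 x = 3 * (2 * re (kap c g beta * (conj (e 0) * conj (e 1) ^+ 2)));
  fd_3 : cf3 x = 2 * re (kap c g beta * conj (e 1) ^+ 3) }.

Definition rep (b c : nat) a beta e x :=
  [/\ Sset b c (a, beta), oriented_basis a beta e & is_form_of c a beta e x].

Lemma orientedE a beta e : oriented_basis a beta e <->
  [/\ areaC (e 0) (e 1) != 0, a = lat (e 0) (e 1) & 0 < nrm beta * areaC (e 0) (e 1)].
Proof.
rewrite /oriented_basis (Zbasis_E C) sqrtE (alg_norm_E C) !conjE.
have Dn := disc_neq0 Dfund.
have -> : (mkq 0 1)^-1 = mkq 0 D%:~R^-1.
  by apply: mulr1_eq; apply: eqC; rewrite !cE; field.
have h : ratr (nrm beta) * (e 0 * conj (e 1) - e 1 * conj (e 0)) * mkq 0 D%:~R^-1 =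
  ratr (- 2 * (nrm beta * areaC (e 0) (e 1))).
  by apply: eqC; rewrite /area !cE; field.
rewrite h; split=> [[[a0 ha] [q q0 hq]]|[a0 ha p0]]; split=> //.
  by have := congr1 re hq; rewrite !re_ratr => hq'; lra.
by exists (- 2 * (nrm beta * areaC (e 0) (e 1))) => //; lra.
Qed.

Lemma formE c a beta e x g : (0 < c)%N -> has_norm C c a g -> is_form_of c a beta e x <->
  [/\ cf0 x = 2 * re (kap c g beta * conj (e 0) ^+ 3),
   cf1 x = 3 * (2 * re (kap c g beta * (conj (e 0) ^+ 2 * conj (e 1)))),
   cf2 x = 3 * (2 * re (kap c g beta * (conj (e 0) * conj (e 1) ^+ 2))) &
   cf3 x = 2 * re (kap c g beta * conj (e 1) ^+ 3)].
Proof.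
move=> c0 hg; have Dn := disc_neq0 Dfund; have cn := c_neq0 c0.
have gn : g != 0 by case: hg => g0 _ _; rewrite gt_eqF.
rewrite /is_form_of (ideal_norm_E Dfund c0 hg) sqrtE.
have -> : beta / (c%:R * mkq 0 1 * ratr (g ^+ 3)) = kap c g beta.
  rewrite /kap -[RHS]mulrA; congr (_ * _); apply: mulr1_eq; apply: eqC; rewrite /codiff !cE; field.
    by rewrite gn cn Dn.
  by rewrite gn cn Dn.
set ka := kap c g beta; set f0 := conj (e 0); set f1 := conj (e 1).
have ev u v : alg_trace (ka * (f0 * ratr u + f1 * ratr v) ^+ 3) =
    2 * re (ka * f0 ^+ 3) * u ^+ 3 + 3 * (2 * re (ka * (f0 ^+ 2 * f1))) * u ^+ 2 * v +
    3 * (2 * re (ka * (f0 * f1 ^+ 2))) * u * v ^+ 2 + 2 * re (ka * f1 ^+ 3) * v ^+ 3.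
  by rewrite (alg_trace_E C) /f0 /f1 !cE; ring.
split=> [h|[h0 h1 h2 h3] w]; last first.
  by rewrite !conjE ev /cf_eval h0 h1 h2 h3.
apply: cubic_ext => u v; rewrite -ev.
by have := h (row2 u v); rewrite /cf_eval row2_0 row2_1 !conjE.
Qed.

Lemma rep_data b c a beta e x : (0 < b)%N -> (0 < c)%N ->
  rep b c a beta e x <-> exists g s, form_data b c a beta e x g s.
Proof.
move=> b0 c0; have cn := c_neq0 c0; split.
  move=> [/(Sset_E C Dfund c0 _ _ b0)[g [hg hN hb]] /orientedE[a0 ha p0]].
  move=> /(formE _ _ _ c0 hg)[h0 h1 h2 h3].
  have g0 : 0 < g by case: (hg).
  have bn : b%:R != 0 :> rat by rewrite pnatr_eq0 -lt0n.
  have g30 : 0 < b%:R * g ^+ 3 by rewrite mulr_gt0 ?ltr0n // exprn_gt0.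
  pose s : rat := if 0 < nrm beta then 1 else -1.
  have s2 : s ^+ 2 = 1 by rewrite /s; case: ifP => _; ring.
  have hn : nrm beta = s * b%:R * g ^+ 3.
    rewrite -mulrA -hN /s; case: ltrP => hh; first by rewrite gtr0_norm ?mul1r.
    by rewrite ler0_norm // mulN1r opprK.
  exists g, s; split=> //.
  (* The norm of a fixes the area up to sign, and the orientation excludes the sign opposite to that
     of N(beta). *)
  have : areaC (e 0) (e 1) ^+ 2 = (s * g * c%:R / 2) ^+ 2.
    have hg' : has_norm C c (lat (e 0) (e 1)) g by rewrite -ha.
    rewrite (area_has_norm Dfund c0 a0 hg').
    have -> : (s * g * c%:R / 2) ^+ 2 = s ^+ 2 * (g ^+ 2 * c%:R ^+ 2 / 4) by field.
    by rewrite s2 mul1r.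
  move=> /eqP; rewrite eqf_sqr => /orP[/eqP //|/eqP hA].
  move: p0; rewrite hA hn.
  have -> : s * b%:R * g ^+ 3 * - (s * g * c%:R / 2) = - (s ^+ 2 * (b%:R * g ^+ 3 * (g * c%:R / 2))).
    by ring.
  rewrite s2 mul1r oppr_gt0 ltNge mulr_ge0 // ltW // divr_gt0 // mulr_gt0 // ltr0n //.
move=> [g [s [_ _ hA ha hg s2 hn hb h0 h1 h2 h3]]].
have g0 : 0 < g by case: (hg).
have sn : s != 0 by apply/eqP => s0; move: s2; rewrite s0 expr0n => /eqP; rewrite eq_sym oner_eq0.
have gn : g != 0 by rewrite gt_eqF.
split.
- apply/(Sset_E C Dfund c0 _ _ b0); exists g; split=> //.
  rewrite hn -mulrA normrM (@ger0_norm _ (b%:R * g ^+ 3)); last by rewrite mulr_ge0 // exprn_ge0 // ltW.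
  have /eqP := s2; rewrite sqrf_eq1 => /orP[/eqP->|/eqP->]; rewrite ?normrN normr1 mul1r //.
- apply/orientedE; split=> //; first by rewrite hA !mulf_neq0.
  have -> : nrm beta * areaC (e 0) (e 1) = s ^+ 2 * (b%:R * g ^+ 3 * (g * c%:R / 2)).
    by rewrite hn hA; ring.
  by rewrite s2 mul1r !(mulr_gt0, divr_gt0, exprn_gt0, ltr0n).
- exact/(formE _ _ _ c0 hg).
Qed.

End Data.

(** * The Hessian covariant and independence of choices *)

(** With x = (x0, 3 y1, 3 y2, x3), these are the coefficients of the Hessian determinant divided by
    -36. *)
Definition hess0 (x : cubic_form) : rat := (cf1 x / 3) ^+ 2 - cf0 x * (cf2 x / 3).
Definition hess1 (x : cubic_form) : rat := cf1 x / 3 * (cf2 x / 3) - cf0 x * cf3 x.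
Definition hess2 (x : cubic_form) : rat := (cf2 x / 3) ^+ 2 - cf1 x / 3 * cf3 x.

Lemma cf_disc_hess x : cf_disc x = - 27 * (hess1 x ^+ 2 - 4 * hess0 x * hess2 x).
Proof. by case: x => x0 x1 x2 x3; rewrite /hess0 /hess1 /hess2 /=; field. Qed.

Definition cf_act (m00 m01 m10 m11 : rat) (x : cubic_form) : cubic_form :=
  let: CubicForm x0 x1 x2 x3 := x in
  CubicForm
    (x0 * m00 ^+ 3 + x1 * m00 ^+ 2 * m01 + x2 * m00 * m01 ^+ 2 + x3 * m01 ^+ 3)
    (3 * x0 * m00 ^+ 2 * m10 + x1 * (m00 ^+ 2 * m11 + 2 * m00 * m10 * m01) +
     x2 * (m10 * m01 ^+ 2 + 2 * m00 * m01 * m11) + 3 * x3 * m01 ^+ 2 * m11)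
    (3 * x0 * m00 * m10 ^+ 2 + x1 * (m10 ^+ 2 * m01 + 2 * m00 * m10 * m11) +
     x2 * (m00 * m11 ^+ 2 + 2 * m10 * m01 * m11) + 3 * x3 * m01 * m11 ^+ 2)
    (x0 * m10 ^+ 3 + x1 * m10 ^+ 2 * m11 + x2 * m10 * m11 ^+ 2 + x3 * m11 ^+ 3).

Lemma mulmx2 (w : 'rV[rat]_2) (M : 'M[int]_2) j :
  (w *m map_mx intr M) 0 j = w 0 0 * (M 0 j)%:~R + w 0 1 * (M 1 j)%:~R.
Proof. by rewrite mxE big_I2 !mxE. Qed.

Lemma cf_act_eval (M : 'M[int]_2) x w :
  cf_eval (cf_act (M 0 0)%:~R (M 0 1)%:~R (M 1 0)%:~R (M 1 1)%:~R x) w =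
  cf_eval x (w *m map_mx intr M).
Proof. by case: x => x0 x1 x2 x3; rewrite /cf_eval !mulmx2 /=; ring. Qed.

Definition mx2 (p q r s : int) : 'M[int]_2 :=
  \matrix_(i, j) if i == 0 then if j == 0 then p else q else if j == 0 then r else s.

Lemma Gamma_mx2 p q r s : p * s - q * r = 1 -> Gamma (mx2 p q r s).
Proof. by move=> h; rewrite /Gamma /= det_2x2 !mxE. Qed.

Lemma orbit_refl x : Gamma_orbit x x.
Proof.
by exists 1%:M => [|w]; [rewrite /Gamma /= det1 | rewrite map_mx1 mulmx1].
Qed.

Lemma orbit_trans x y z : Gamma_orbit x y -> Gamma_orbit y z -> Gamma_orbit x z.
Proof.
move=> [g hg hy] [h hh hz]; exists (h *m g); first by rewrite /Gamma /= det_mulmx hh hg mulr1.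
by move=> w; rewrite hz hy map_mxM mulmxA.
Qed.

Lemma orbit_sym x y : Gamma_orbit x y -> Gamma_orbit y x.
Proof.
move=> [g hg hy]; have hadj : \adj g *m g = 1%:M by rewrite mul_adj_mx hg.
exists (\adj g).
  by have := congr1 determinant hadj; rewrite det_mulmx hg mulr1 det1.
by move=> w; rewrite hy -mulmxA -map_mxM hadj map_mx1 mulmx1.
Qed.

Lemma orbit_eq x y : Gamma_orbit x y -> Gamma_orbit x = Gamma_orbit y.
Proof.
move=> xy; rewrite eqEsubset; split=> z hz; first exact: orbit_trans (orbit_sym xy) hz.
exact: orbit_trans xy hz.
Qed.

Lemma orbit_act (p q r s : int) x : p * s - q * r = 1 ->
  Gamma_orbit x (cf_act p%:~R q%:~R r%:~R s%:~R x).
Proof.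
move=> h; exists (mx2 p q r s); first exact: Gamma_mx2.
by move=> w; rewrite -cf_act_eval !mxE.
Qed.

Lemma Ldual_act (n p q r s : int) x : p * s - q * r = 1 ->
  Ldual_n n x -> Ldual_n n (cf_act p%:~R q%:~R r%:~R s%:~R x).
Proof.
case: x => x0 x1 x2 x3 h [[[/= h0 h1 h2 h3] [[a ha] [b hb]]] hd].
have rp (z : int) : z%:~R \is a @Num.int rat := intr_int _ z.
have rn (z : nat) : z%:R \is a @Num.int rat by rewrite pmulrn.
split; last first.
  rewrite -hd /=.
  have hq : p%:~R * s%:~R - q%:~R * r%:~R = 1 :> rat by rewrite -!intrM -rmorphB h.
  transitivity ((p%:~R * s%:~R - q%:~R * r%:~R) ^+ 6 * cf_disc (CubicForm x0 x1 x2 x3)).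
    by rewrite /=; ring.
  by rewrite hq expr1n mul1r.
split; last split.
- split=> /=; rewrite ?(rpredD, rpredM, rpredX) ?rp ?rn //.
- have /intrP[i hi] : x0 * p%:~R ^+ 2 * r%:~R + a%:~R * (p%:~R ^+ 2 * s%:~R + 2 * p%:~R * r%:~R * q%:~R) +
     b%:~R * (r%:~R * q%:~R ^+ 2 + 2 * p%:~R * q%:~R * s%:~R) + x3 * q%:~R ^+ 2 * s%:~R \is a Num.int.
    by rewrite ?(rpredD, rpredM, rpredX) ?rp ?rn.
  by exists i; rewrite intrM -hi /= ha hb !intrM; ring.
have /intrP[i hi] : x0 * p%:~R * r%:~R ^+ 2 + a%:~R * (r%:~R ^+ 2 * q%:~R + 2 * p%:~R * r%:~R * s%:~R) +
   b%:~R * (p%:~R * s%:~R ^+ 2 + 2 * r%:~R * q%:~R * s%:~R) + x3 * q%:~R * s%:~R ^+ 2 \is a Num.int.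
  by rewrite ?(rpredD, rpredM, rpredX) ?rp ?rn.
by exists i; rewrite intrM -hi /= ha hb !intrM; ring.
Qed.

(* The Hessian is a covariant, and a nonzero binary quadratic form does not
   vanish at all of (1,0), (0,1) and (1,1). *)
Lemma orbit_hess0 n x : n <> 0 -> Ldual_n n x ->
  exists y, [/\ Gamma_orbit x y, Ldual_n n y & hess0 y != 0].
Proof.
move=> n0 hx; have [h0|h0] := eqVneq (hess0 x) 0; last first.
  by exists x; split=> //; exact: orbit_refl.
have [h2|h2] := eqVneq (hess2 x) 0; last first.
  exists (cf_act 0%:~R 1%:~R (-1)%:~R 0%:~R x); split; first exact: orbit_act.
    exact: Ldual_act.
  rewrite (_ : hess0 _ = hess2 x) //; case: (x) => x0 x1 x2 x3.
  by rewrite /hess0 /hess2 /=; field.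
exists (cf_act 1%:~R 1%:~R 0%:~R 1%:~R x); split; first exact: orbit_act.
  exact: Ldual_act.
rewrite (_ : hess0 _ = hess0 x + hess1 x + hess2 x); last first.
  by case: (x) => x0 x1 x2 x3; rewrite /hess0 /hess1 /hess2 /=; field.
rewrite h0 h2 addr0 add0r; apply/eqP => h1; case: hx => _.
rewrite cf_disc_hess h0 h1 h2 => /eqP.
rewrite (_ : -27 * _ = 0); last by ring.
by rewrite eq_sym intr_eq0 mulf_eq0 /= => /eqP.
Qed.

Section Rep.
Variables (k : quad_alg) (D : int) (C : quad_coord k D).
Hypothesis Dfund : fundamental D.
Hypothesis conjE : forall x : k, qconj x = conj C x.
Hypothesis sqrtE : qsqrtD k = mkq C 0 1.
Local Notation re := (re C).
Local Notation im := (im C).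
Local Notation mkq := (mkq C).
Local Notation nrm := (qnorm C).
Local Notation conj := (conj C).
Local Notation areaC := (area C).
Local Notation eqC := (@eq_coord _ _ C).
Implicit Types (a : set k) (beta : k) (e : 'I_2 -> k) (x : cubic_form).

Let Dn : D%:~R != 0 :> rat := disc_neq0 Dfund.

Lemma sign_cases (s : rat) : s ^+ 2 = 1 -> s = 1 \/ s = -1.
Proof. by move=> /eqP; rewrite sqrf_eq1 => /orP[/eqP->|/eqP->]; [left|right]. Qed.

Lemma lat_sign (s : rat) (u v : k) : s ^+ 2 = 1 -> lat (ratr s * u) (ratr s * v) = lat u v.
Proof.
case/sign_cases=> ->; first by rewrite (_ : ratr 1 = 1) ?mul1r //; apply: eqC; rewrite !cE.
have -> : ratr (-1) = -1 :> k by apply: eqC; rewrite !cE.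
by rewrite eqEsubset; split=> _ [m [n ->]]; exists (- m), (- n); rewrite !rmorphN /=; ring.
Qed.

Lemma fd_g0 b c a beta e x g s : form_data C b c a beta e x g s -> 0 < g.
Proof. by case=> _ _ _ _ [g0 _ _]. Qed.

(** For x = Tr(kappa l^3) with l = conj(e0) u + conj(e1) v, the Hessian is -4 D area^2 N(kappa)
    N(l). As N(kappa) = -s b / (c^2 D g^3) and area^2 = g^2 c^2 / 4, the scalar is s b / g. *)
Lemma form_hess b c a beta e x g s : form_data C b c a beta e x g s ->
  [/\ hess0 x = s * b%:R * (nrm (e 0) / g),
   hess1 x = s * b%:R * (2 * re (e 0 * conj (e 1)) / g) &
   hess2 x = s * b%:R * (nrm (e 1) / g)].
Proof.
move=> F; have g0 := fd_g0 F; have gn : g != 0 by rewrite gt_eqF.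
case: F => b0 c0 hA _ _ s2 hn _ h0 h1 h2 h3; have cn := c_neq0 c0.
have nk : nrm (kap C c g beta) = - s * b%:R / (c%:R ^+ 2 * D%:~R * g ^+ 3).
  rewrite /kap 2!(nrmM C) hn /codiff /qnorm !cE; field.
  by rewrite gn cn Dn.
have hc : - nrm (kap C c g beta) * (4 * D%:~R * areaC (e 0) (e 1) ^+ 2) = s * b%:R / g.
  rewrite nk hA (_ : (s * g * c%:R / 2) ^+ 2 = s ^+ 2 * (g * c%:R) ^+ 2 / 4); last by field.
  by rewrite s2; field; rewrite gn cn Dn.
have hs y : s * b%:R * (y / g) = - nrm (kap C c g beta) * (4 * D%:~R * areaC (e 0) (e 1) ^+ 2) * y.
  by rewrite hc; field.
rewrite /hess0 /hess1 /hess2 h0 h1 h2 h3 !hs; move: (kap C c g beta) => ka.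
by split; rewrite /area /qnorm !cE; field.
Qed.

Lemma form_disc b c a beta e x g s : form_data C b c a beta e x g s ->
  cf_disc x = - 27 * ((b * c)%:R ^+ 2 * D%:~R).
Proof.
move=> F; have g0 := fd_g0 F; have gn : g != 0 by rewrite gt_eqF.
have [h0 h1 h2] := form_hess F; rewrite cf_disc_hess h0 h1 h2.
have hA := fd_area F; have s2 := fd_s F; congr (_ * _).
have -> : (b * c)%:R = b%:R * c%:R :> rat by rewrite -natrM.
transitivity (s ^+ 2 * b%:R ^+ 2 / g ^+ 2 * (4 * D%:~R * areaC (e 0) (e 1) ^+ 2)).
  by rewrite /area /qnorm !cE; field.
rewrite hA (_ : (s * g * c%:R / 2) ^+ 2 = s ^+ 2 * (g * c%:R) ^+ 2 / 4); last by field.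
by rewrite s2; field.
Qed.

Lemma form_Ldual b c a beta e x g s n : form_data C b c a beta e x g s ->
  n%:~R = (b * c)%:R ^+ 2 * D%:~R :> rat -> Ldual_n n x.
Proof.
move=> F hn; split; last by rewrite (form_disc F) -hn intrM.
case: F => b0 c0 hA ha hg _ _ hb h0 h1 h2 h3.
rewrite ha in hg hb.
have [i0 /intrP[i hi] /intrP[j hj] i3] := (mem_cubeP Dfund c0 _ hg).1 hb.
split; last by split; [exists i; rewrite h1 hi intrM | exists j; rewrite h2 hj intrM].
split; first by rewrite h0.
- by rewrite h1 hi rpredM // ?intr_int // pmulrn intr_int.
- by rewrite h2 hj rpredM // ?intr_int // pmulrn intr_int.
- by rewrite h3.
Qed.

Lemma rep_exists b c a beta : (0 < b)%N -> (0 < c)%N -> Sset b c (a, beta) ->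
  exists e x, rep b c a beta e x.
Proof.
move=> b0 c0 hS; have [g [hg hN hb]] := (Sset_E C Dfund c0 _ _ b0).1 hS.
have [g0 [/(is_lattice_E C)[e0 [e1 [a0 ha]]] _] _] := hg.
have bn : nrm beta != 0.
  by rewrite -normr_eq0 hN mulf_neq0 ?pnatr_eq0 -?lt0n // expf_neq0 // gt_eqF.
have [e he] : exists e, oriented_basis a beta e.
  have [p0|p0] := ltP 0 (nrm beta * areaC e0 e1).
    by exists (vec2 e0 e1); apply/(orientedE Dfund conjE sqrtE).
  have aE : areaC e1 e0 = - areaC e0 e1 by rewrite /area; ring.
  exists (vec2 e1 e0); apply/(orientedE Dfund conjE sqrtE); rewrite /vec2 /=.
  rewrite aE oppr_eq0 mulrN oppr_gt0 lt_neqAle p0 mulf_neq0 //; split=> //.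
  rewrite ha eqEsubset; split=> _ [m [n ->]]; exists n, m; ring.
exists e, (CubicForm (2 * re (kap C c g beta * conj (e 0) ^+ 3))
  (3 * (2 * re (kap C c g beta * (conj (e 0) ^+ 2 * conj (e 1)))))
  (3 * (2 * re (kap C c g beta * (conj (e 0) * conj (e 1) ^+ 2))))
  (2 * re (kap C c g beta * conj (e 1) ^+ 3))).
by split=> //; apply/(formE Dfund conjE sqrtE _ _ _ c0 hg).
Qed.

(** * Independence of the basis and of the representative *)

Definition bact (M : 'M[int]_2) e : 'I_2 -> k :=
  fun i => (M i 0)%:~R * e 0 + (M i 1)%:~R * e 1.

Lemma area_bact M e : areaC (bact M e 0) (bact M e 1) = (\det M)%:~R * areaC (e 0) (e 1).
Proof. by rewrite det_2x2 rmorphB /= !intrM /area /bact !cE; ring. Qed.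

Lemma lat_bact M e : Gamma M -> lat (bact M e 0) (bact M e 1) = lat (e 0) (e 1).
Proof.
rewrite /Gamma /= det_2x2 => hM; rewrite eqEsubset; split=> _ [m [n ->]].
  exists (m * M 0 0 + n * M 1 0), (m * M 0 1 + n * M 1 1).
  by rewrite /bact !intrD !intrM; ring.
exists (m * M 1 1 - n * M 1 0), (n * M 0 0 - m * M 0 1).
have hK : (M 0 0)%:~R * (M 1 1)%:~R - (M 0 1)%:~R * (M 1 0)%:~R = 1 :> k.
  by rewrite -!intrM -rmorphB hM.
transitivity (((M 0 0)%:~R * (M 1 1)%:~R - (M 0 1)%:~R * (M 1 0)%:~R) * (m%:~R * e 0 + n%:~R * e 1)).
  by rewrite hK mul1r.
by rewrite /bact !rmorphB /= !intrM; ring.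
Qed.

(** Taking the rows of [M] as new basis vectors amounts to substituting (u, v) M, the convention of
    [Gamma_orbit]. *)
Lemma form_bact c a beta M e x y : is_form_of c a beta e x ->
  (is_form_of c a beta (bact M e) y <->
   forall w, cf_eval y w = cf_eval x (w *m map_mx intr M)).
Proof.
move=> hx; have h (w : 'rV[rat]_2) : (qconj (bact M e 0) * ratr (w 0 0) + qconj (bact M e 1) * ratr (w 0 1)) =
   (qconj (e 0) * ratr ((w *m map_mx intr M) 0 0) + qconj (e 1) * ratr ((w *m map_mx intr M) 0 1)).
  by rewrite !mulmx2 !conjE /bact; apply: eqC; rewrite !cE; ring.
by split=> hy w; [rewrite hx -h -hy | rewrite hy hx h].
Qed.

Lemma rep_bact b c a beta M e x y : rep b c a beta e x -> Gamma M ->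
  (forall w, cf_eval y w = cf_eval x (w *m map_mx intr M)) ->
  rep b c a beta (bact M e) y.
Proof.
move=> [hS /(orientedE Dfund conjE sqrtE)[a0 ha p0] hf] hM hy; split=> //.
  by apply/(orientedE Dfund conjE sqrtE); rewrite area_bact lat_bact // hM mul1r.
exact/(form_bact _ _ hf).
Qed.

Lemma rep_orbit b c a beta e x y : rep b c a beta e x -> Gamma_orbit x y ->
  exists e', rep b c a beta e' y.
Proof. by move=> hr [M hM hy]; exists (bact M e); apply: rep_bact hr hM hy. Qed.

(** Two bases of a differ by a matrix of determinant 1 or -1; equal orientation leaves 1. *)
Lemma rep_unique b c a beta e1 e2 x1 x2 :
  rep b c a beta e1 x1 -> rep b c a beta e2 x2 -> Gamma_orbit x1 x2.
Proof.
move=> [hS /(orientedE Dfund conjE sqrtE)[a1 h1 p1] f1] [_ /(orientedE Dfund conjE sqrtE)[a2 h2 p2] f2].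
rewrite h2 in h1; have [m [n [p [q [e1E e2E hdet]]]]] := lat_change (esym h1) a1.
have eE i : e2 i = bact (mx2 m n p q) e1 i.
  rewrite /bact !mxE /=; case: i => -[|[|//]] lt.
    by rewrite -e1E; congr e2; apply/val_inj.
  by rewrite -e2E; congr e2; apply/val_inj.
have e2E' : e2 = bact (mx2 m n p q) e1 by apply/funext.
exists (mx2 m n p q); last by apply/(form_bact _ _ f1); rewrite -e2E'.
move: p2; rewrite e2E' area_bact mulrCA => p2.
have : 0 < ((\det (mx2 m n p q))%:~R : rat) by rewrite -(pmulr_lgt0 _ p1).
rewrite ltr0z /Gamma /= det_2x2 !mxE /= => hp.
move: hdet => /eqP; rewrite sqrf_eq1 => /orP[/eqP //|/eqP hm].
by move: hp; rewrite hm.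
Qed.

Lemma Sequiv_orbit b c a1 beta1 e1 x1 a2 beta2 e2 x2 : (0 < b)%N -> (0 < c)%N ->
  rep b c a1 beta1 e1 x1 -> rep b c a2 beta2 e2 x2 ->
  Sequiv (a1, beta1) (a2, beta2) -> Gamma_orbit x1 x2.
Proof.
move=> b0 c0 r1 r2 [rho [urho /= ha hb]].
have [g [s F]] := (rep_data Dfund conjE sqrtE _ _ _ _ b0 c0).1 r1.
have g0 := fd_g0 F; have gn : g != 0 by rewrite gt_eqF.
rewrite (unit_nrm C) in urho; pose N := nrm rho.
have hg2 : has_norm C c a2 (`|N| * g).
  by rewrite -ha; exact: (has_norm_scale Dfund c0 urho (fd_norm F)).
pose t : rat := if 0 < N then 1 else -1.
have t2 : t ^+ 2 = 1 by rewrite /t; case: ifP => _; ring.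
have tN : `|N| = t * N.
  rewrite /t; case: ltrP => h; first by rewrite gtr0_norm ?mul1r.
  by rewrite ler0_norm // mulN1r.
have tn : t != 0 by apply/eqP => t0; move: t2; rewrite t0 expr0n => /eqP; rewrite eq_sym oner_eq0.
have Nn : N != 0 := urho.
(* The norm of rho a is |N(rho)| g, whereas N(rho)^3 appears in the form; with the basis rho e1
   alone the form would be multiplied by the sign [t]. *)
pose e' i := ratr t * rho * e1 i.
suff r' : rep b c a2 beta2 e' x1 by apply: rep_unique r' r2.
case: r1 r2 => [S1 /(orientedE Dfund conjE sqrtE)[A1 l1 p1] f1] [S2 _ _]; split=> //.
  have hA : areaC (e' 0) (e' 1) = N * areaC (e1 0) (e1 1).
    transitivity (t ^+ 2 * (N * areaC (e1 0) (e1 1))); last by rewrite t2 mul1r.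
    by rewrite /e' /N /qnorm /area !cE; ring.
  apply/(orientedE Dfund conjE sqrtE); rewrite hA -hb mulf_neq0 //; split=> //.
    by rewrite -ha l1 scale_lat /e' -!(mulrA (ratr t)) lat_sign.
  rewrite !(nrmM C) -[nrm rho]/N.
  (* N(beta) gains N(rho)^3 and the area gains N(rho), so orientation is kept whatever the sign of
     N(rho). *)
  rewrite (_ : _ * _ = N ^+ 2 * N ^+ 2 * (nrm beta1 * areaC (e1 0) (e1 1))); last by ring.
  apply: mulr_gt0 => //; apply: mulr_gt0; by rewrite exprn_even_gt0.
apply/(formE Dfund conjE sqrtE _ _ _ c0 hg2).
have [h0 h1 h2 h3] := (formE Dfund conjE sqrtE _ _ _ c0 (fd_norm F)).1 f1.
have hk : kap C c (`|N| * g) beta2 * conj (ratr t * rho) ^+ 3 = kap C c g beta1.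
  transitivity (kap C c g beta1 * ((rho * conj rho) ^+ 3 * ratr (t ^+ 3 / (t * N) ^+ 3))).
    rewrite /kap -hb tN; have -> : conj (ratr t * rho) = ratr t * conj rho.
      by rewrite conjM conj_ratr.
    have -> : ratr ((t * N * g) ^+ 3)^-1 = ratr ((t * N) ^+ 3)^-1 * ratr (g ^+ 3)^-1 :> k.
      by apply: eqC; rewrite !cE; field; rewrite ?gn ?Nn ?tn.
    have -> : ratr (t ^+ 3 / (t * N) ^+ 3) = ratr t ^+ 3 * ratr ((t * N) ^+ 3)^-1 :> k.
      by apply: eqC; rewrite !cE; field; rewrite ?gn ?Nn ?tn.
    by ring.
  rewrite mul_conj -[nrm rho]/N (_ : _ * ratr _ = 1) ?mulr1 //.
  by apply: eqC; rewrite !cE; field; rewrite ?Nn ?tn.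
have ee i : conj (e' i) = conj (ratr t * rho) * conj (e1 i) by rewrite -conjM.
rewrite h0 h1 h2 h3 -hk !ee; split; rewrite ?exprMn; congr (_ * re _) || congr (3 * (2 * re _)).
- by ring.
- by ring.
- by ring.
- by ring.
Qed.

End Rep.

(** * Injectivity and surjectivity *)

Section Main.
Variables (k : quad_alg) (D : int) (C : quad_coord k D).
Hypothesis Dfund : fundamental D.
Hypothesis conjE : forall x : k, qconj x = conj C x.
Hypothesis sqrtE : qsqrtD k = mkq C 0 1.
Local Notation re := (re C).
Local Notation im := (im C).
Local Notation mkq := (mkq C).
Local Notation nrm := (qnorm C).
Local Notation conj := (conj C).
Local Notation areaC := (area C).
Local Notation om := (om C).
Local Notation eqC := (@eq_coord _ _ C).
Implicit Types (a : set k) (beta : k) (e : 'I_2 -> k) (x : cubic_form).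

Let Dn : D%:~R != 0 :> rat := disc_neq0 Dfund.

Lemma form_content b c a beta e x g s : form_data C b c a beta e x g s ->
  exists A B Cc u v w : int, [/\ hess0 x = b%:R * A%:~R, hess1 x = b%:R * B%:~R,
    hess2 x = b%:R * Cc%:~R & u * A + v * B + w * Cc = 1].
Proof.
move=> F; have g0 := fd_g0 F; have gn : g != 0 by rewrite gt_eqF.
have [H0 H1 H2] := form_hess Dfund F.
case: F => b0 c0 hA ha hg s2 _ _ _ _ _ _; have cn := c_neq0 c0.
have a0 : areaC (e 0) (e 1) != 0.
  by rewrite hA !mulf_neq0 //; apply: contra_eq_neq s2 => ->; rewrite expr0n eq_sym oner_eq0.
rewrite ha in hg.
have inv : invertible (@order_c k c) (lat (e 0) (e 1)).
  by apply/(invertible_has_norm C Dfund c0); exists g.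
have [g' [A [B [Cc [u [v [w [hg' nA nB nC [huvw _]]]]]]]]] := invertible_data Dfund c0 a0 inv.
rewrite -(has_norm_uniq Dfund c0 hg hg') in nA nB nC.
have [t ht t2] : exists2 t : int, s = t%:~R & t * t = 1.
  by case/sign_cases: s2 => ->; [exists 1 | exists (-1)].
exists (t * A), (t * B), (t * Cc), (t * u), (t * v), (t * w).
rewrite H0 H1 H2 nA nB nC ht !intrM; split; try by field.
transitivity (t * t * (u * A + v * B + w * Cc)); first by ring.
by rewrite t2 huvw.
Qed.

Lemma form_bc b1 c1 a1 beta1 e1 g1 s1 b2 c2 a2 beta2 e2 g2 s2 x :
  form_data C b1 c1 a1 beta1 e1 x g1 s1 -> form_data C b2 c2 a2 beta2 e2 x g2 s2 ->
  b1 = b2 /\ c1 = c2.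
Proof.
move=> F1 F2; have b10 := fd_b F1; have b20 := fd_b F2.
have hb : b1 = b2.
  have [A [B [Cc [u [v [w [h0 h1 h2 h]]]]]]] := form_content F1.
  have [A' [B' [Cc' [u' [v' [w' [h0' h1' h2' h']]]]]]] := form_content F2.
  (* The Bezout combination for the first form, applied to the common Hessian coefficients, gives b1
     on one side and a multiple of b2 on the other. By symmetry each divides the other. *)
  have e1' : b1%:Z = b2%:Z * (u * A' + v * B' + w * Cc').
    apply/eqP; rewrite -(eqr_int rat) intrM !intrD !intrM -!pmulrn; apply/eqP.
    transitivity (b1%:R * (u * A + v * B + w * Cc)%:~R : rat); first by rewrite h mulr1.
    rewrite !intrD !intrM; move: h0' h1' h2'; rewrite h0 h1 h2 => H0 H1 H2.
    transitivity (u%:~R * (b1%:R * A%:~R) + v%:~R * (b1%:R * B%:~R) + w%:~R * (b1%:R * Cc%:~R) : rat); first by ring.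
    by rewrite H0 H1 H2; ring.
  have e2' : b2%:Z = b1%:Z * (u' * A + v' * B + w' * Cc).
    apply/eqP; rewrite -(eqr_int rat) intrM !intrD !intrM -!pmulrn; apply/eqP.
    transitivity (b2%:R * (u' * A' + v' * B' + w' * Cc')%:~R : rat); first by rewrite h' mulr1.
    rewrite !intrD !intrM; move: h0' h1' h2'; rewrite h0 h1 h2 => H0 H1 H2.
    transitivity (u'%:~R * (b2%:R * A'%:~R) + v'%:~R * (b2%:R * B'%:~R) + w'%:~R * (b2%:R * Cc'%:~R) : rat); first by ring.
    by rewrite -H0 -H1 -H2; ring.
  move: e1' e2'; move: (u * A' + _ + _) (u' * A + _ + _) => z z' e1' e2'.
  have z0 : 0 < z by nia.
  have z0' : 0 < z' by nia.
  by nia.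
split=> //; have := form_disc Dfund F1; rewrite (form_disc Dfund F2) -hb.
move=> /(mulfI _) h; have {h} : (b1 * c2)%:R ^+ 2 * D%:~R = (b1 * c1)%:R ^+ 2 * D%:~R :> rat.
  by apply: h.
move=> /(mulIf Dn)/eqP; rewrite eqrXn2 // ?ler0n // eqr_nat eqn_pmul2l //.
by move=> /eqP.
Qed.

(** conj(e0) e1 has real part read off [hess1] and imaginary part equal to the area, hence is s g (B
    + c sqrt D)/2; multiplying by e0 and using N(e0) = s g A gives the ratio. The area fixes the
    sign of sqrt D, and nothing but x and c remains. *)
Lemma basis_ratio b c a beta e x g s (A B : rat) : form_data C b c a beta e x g s ->
  hess0 x = b%:R * A -> hess1 x = b%:R * B ->
  nrm (e 0) = s * g * A /\ ratr A * e 1 = mkq (B / 2) (c%:R / 2) * e 0.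
Proof.
move=> F; have g0 := fd_g0 F; have gn : g != 0 by rewrite gt_eqF.
have [H0 H1 _] := form_hess Dfund F; rewrite H0 H1 => hA' hB'.
have s2 := fd_s F; have b0 := fd_b F.
have bn : b%:R != 0 :> rat by rewrite pnatr_eq0 -lt0n.
have sn : s != 0 by apply/eqP => s0; move: s2; rewrite s0 expr0n => /eqP; rewrite eq_sym oner_eq0.
have cancel y Y : s * b%:R * (y / g) = b%:R * Y -> y = s * g * Y.
  move=> h; apply: (mulIf bn); transitivity (s ^+ 2 * y * b%:R); first by rewrite s2 mul1r.
  by transitivity (s * g * (s * b%:R * (y / g))); [field | rewrite h; ring].
have hA := cancel _ _ hA'; have hB := cancel _ _ hB'.
split=> //.
have h : conj (e 0) * e 1 = ratr (s * g) * mkq (B / 2) (c%:R / 2).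
  have ha := fd_area F; apply: eqC.
    by move: hB; rewrite !cE; lra.
  by move: ha; rewrite /area !cE; lra.
transitivity (ratr (s * g)^-1 * (e 0 * conj (e 0)) * e 1).
  by rewrite mul_conj hA; congr (_ * _); apply: eqC; rewrite !cE; field; rewrite ?gn ?sn.
transitivity (ratr (s * g)^-1 * (conj (e 0) * e 1) * e 0); first by ring.
by rewrite h; apply: eqC; rewrite !cE; field; rewrite ?gn ?sn.
Qed.

Lemma form_Sequiv b c a1 beta1 e1 g1 s1 a2 beta2 e2 g2 s2 x :
  form_data C b c a1 beta1 e1 x g1 s1 -> form_data C b c a2 beta2 e2 x g2 s2 ->
  hess0 x != 0 -> Sequiv (a1, beta1) (a2, beta2).
Proof.
move=> F1 F2 hx; have b0 := fd_b F1; have c0 := fd_c F1; have cn := c_neq0 c0.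
have bn : b%:R != 0 :> rat by rewrite pnatr_eq0 -lt0n.
have [A hA] : exists A : rat, hess0 x = b%:R * A by exists (hess0 x / b%:R); field.
have [B hB] : exists B : rat, hess1 x = b%:R * B by exists (hess1 x / b%:R); field.
have An : A != 0 by apply: contraNneq hx => h; rewrite hA h mulr0.
have [N1 E1] := basis_ratio F1 hA hB; have [N2 E2] := basis_ratio F2 hA hB.
have g10 := fd_g0 F1; have g20 := fd_g0 F2.
have g1n : g1 != 0 by rewrite gt_eqF.
have g2n : g2 != 0 by rewrite gt_eqF.
have sn (s : rat) : s ^+ 2 = 1 -> s != 0.
  by move=> h; apply/eqP => s0; move: h; rewrite s0 expr0n => /eqP; rewrite eq_sym oner_eq0.
have s12 := fd_s F1; have s22 := fd_s F2; have s1n := sn _ s12; have s2n := sn _ s22.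
have u1 : e1 0 \is a GRing.unit by rewrite (unit_nrm C) N1 !mulf_neq0.
have u2 : e2 0 \is a GRing.unit by rewrite (unit_nrm C) N2 !mulf_neq0.
pose rho := e2 0 / e1 0; have h0 : e2 0 = rho * e1 0 by rewrite mulrVK.
have h1 : e2 1 = rho * e1 1.
  transitivity (ratr A^-1 * (ratr A * e2 1)); first by apply: eqC; rewrite !cE; field.
  rewrite E2 h0; transitivity (ratr A^-1 * rho * (ratr A * e1 1)); first by rewrite E1; ring.
  by apply: eqC; rewrite !cE; field.
pose mu i (g : rat) beta (e : 'I_2 -> k) : k := kap C c g beta * conj (e i) ^+ 3.
(* The real part of kappa conj(e0)^3 is half of x0. Since e1 / e0 is known, x1 is another linear
   combination of its two coordinates, which determines the imaginary part. *)
have hmu : mu 0 g1 beta1 e1 = mu 0 g2 beta2 e2.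
  have hr : re (mu 0 g1 beta1 e1) = re (mu 0 g2 beta2 e2).
    by have := fd_0 F1; rewrite (fd_0 F2) /mu; lra.
  have hi g beta e : ratr A * e 1 = mkq (B / 2) (c%:R / 2) * e 0 ->
     A * re (kap C c g beta * (conj (e 0) ^+ 2 * conj (e 1))) =
     re (mu 0 g beta e) * (B / 2) - D%:~R * im (mu 0 g beta e) * (c%:R / 2).
    move=> he; transitivity (re (mu 0 g beta e * conj (mkq (B / 2) (c%:R / 2)))); last first.
      by rewrite [LHS]reM re_conj im_conj re_mkq im_mkq; ring.
    have -> : mu 0 g beta e * conj (mkq (B / 2) (c%:R / 2)) =
       kap C c g beta * conj (e 0) ^+ 2 * conj (mkq (B / 2) (c%:R / 2) * e 0).
      by rewrite conjM /mu; ring.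
    rewrite -he conjM conj_ratr.
    transitivity (re (ratr A * (kap C c g beta * (conj (e 0) ^+ 2 * conj (e 1))))).
      by rewrite [RHS]reM re_ratr im_ratr; ring.
    by congr re; ring.
  apply: eqC => //; have := hi g1 beta1 e1 E1; have := hi g2 beta2 e2 E2.
  have -> : re (kap C c g2 beta2 * (conj (e2 0) ^+ 2 * conj (e2 1))) =
     re (kap C c g1 beta1 * (conj (e1 0) ^+ 2 * conj (e1 1))).
    by have := fd_1 F1; rewrite (fd_1 F2); lra.
  move=> -> ; rewrite hr => h.
  have dn : D%:~R * (c%:R / 2) != 0 :> rat by rewrite !mulf_neq0.
  by apply: (mulfI dn); lra.
(* Multiplying by e0^3 produces N(e0)^3 = s g^3 A^3, whose g^3 cancels the denominator of kappa. *)
have hN (g s : rat) beta e : s ^+ 2 = 1 -> g != 0 -> nrm (e 0) = s * g * A ->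
    mu 0 g beta e * e 0 ^+ 3 = beta * codiff C c * ratr (s * A ^+ 3).
  move=> hs hg hn; transitivity (kap C c g beta * (e 0 * conj (e 0)) ^+ 3).
    by rewrite /mu; ring.
  rewrite mul_conj hn /kap -mulrA; congr (_ * _).
  have -> : s * A ^+ 3 = s ^+ 2 * s * A ^+ 3 by rewrite hs mul1r.
  by apply: eqC; rewrite !cE; field.
(* The sign s1 s2, left over from N(e0) on both sides, equals its own cube and can be absorbed into
   rho. *)
have hb : beta2 = (ratr (s1 * s2) * rho) ^+ 3 * beta1.
  have E : beta2 * codiff C c * ratr (s2 * A ^+ 3) = rho ^+ 3 * (beta1 * codiff C c * ratr (s1 * A ^+ 3)).
    rewrite -(hN g2 s2 beta2 e2) // -(hN g1 s1 beta1 e1) // hmu h0; ring.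
  have cd : codiff C c * mkq 0 c%:R = 1.
    by apply: eqC; rewrite /codiff !cE; field; rewrite ?cn ?Dn.
  have As (s : rat) : s ^+ 2 = 1 -> ratr (s * A ^+ 3) * ratr (s2 * A ^- 3) = ratr (s * s2) :> k.
    by move=> _; apply: eqC; rewrite !cE; field.
  transitivity (beta2 * codiff C c * ratr (s2 * A ^+ 3) * mkq 0 c%:R * ratr (s2 * A ^- 3)).
    transitivity (beta2 * (codiff C c * mkq 0 c%:R) * (ratr (s2 * A ^+ 3) * ratr (s2 * A ^- 3))); last by ring.
    rewrite cd As // -expr2 s22 (_ : ratr 1 = 1) ?mulr1 //; by apply: eqC; rewrite !cE.
  rewrite E.
  transitivity (rho ^+ 3 * beta1 * (codiff C c * mkq 0 c%:R) * (ratr (s1 * A ^+ 3) * ratr (s2 * A ^- 3))); first by ring.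
  have r3 : ratr (s1 * s2) ^+ 3 = ratr (s1 * s2) :> k.
    have e3 : (s1 * s2) ^+ 3 = s1 * s2 by rewrite exprS exprMn s12 s22; ring.
    by rewrite -[in RHS]e3; apply: eqC; rewrite !cE; ring.
  rewrite cd As //; transitivity (rho ^+ 3 * ratr (s1 * s2) ^+ 3 * beta1); last by ring.
  by rewrite r3; ring.
exists (ratr (s1 * s2) * rho); split=> //=.
  rewrite unitrM; apply/andP; split; last by rewrite unitrMl ?unitrV.
  by rewrite (unit_nrm C) /qnorm !cE expr0n mulr0 subr0 expf_neq0 // mulf_neq0.
have ss : (s1 * s2) ^+ 2 = 1 by rewrite exprMn s12 s22 mulr1.
by rewrite (fd_lat F1) (fd_lat F2) scale_lat -(mulrA _ rho (e1 0)) -(mulrA _ rho (e1 1)) (lat_sign C) // -h0 -h1.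
Qed.

Lemma Sequiv_sym p q : Sequiv p q -> @Sequiv k q p.
Proof.
case: p q => [a beta] [a' beta'] [rho [ur /= ha hb]]; exists rho^-1; split=> /=.
- by rewrite unitrV.
- by rewrite -ha scaleA mulVr // scale1.
- by rewrite -hb mulrA -exprMn mulVr // expr1n mul1r.
Qed.

Lemma Sequiv_trans p q r : Sequiv p q -> Sequiv q r -> @Sequiv k p r.
Proof.
case: p q r => [a beta] [a' beta'] [a'' beta''] [rho [ur /= ha hb]] [sg [us /= ha' hb']].
exists (sg * rho); split=> /=; first by rewrite unitrM us ur.
  by rewrite -ha' -ha scaleA.
by rewrite -hb' -hb mulrA -exprMn.
Qed.

Lemma Sequiv_refl p : @Sequiv k p p.
Proof.
by case: p => a b; exists 1; split=> /=; rewrite ?unitr1 ?scale1 ?expr1n ?mul1r.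
Qed.

(* With x = (x0, 3 y1, 3 y2, x3) and H = b (A, B, Cc), apolarity
   A y_{i+2} - B y_{i+1} + Cc y_i = 0 makes the coefficients a linear
   recurrence, whose characteristic root is th / A with th as below. *)
Lemma rep_surj n x (m : rat) : n%:~R = m ^+ 2 * D%:~R -> n <> 0 -> Ldual_n n x ->
  hess0 x != 0 -> exists b c a beta e,
  [/\ (0 < b)%N, (0 < c)%N, n%:~R = (b * c)%:R ^+ 2 * D%:~R :> rat & rep b c a beta e x].
Proof.
move=> hn n0 [[[/intrP[x0 X0] _ _ /intrP[x3 X3]] [[y1 X1] [y2 X2]]] hdisc] h0.
have Y1 : cf1 x / 3 = y1%:~R by rewrite X1 intrM; field.
have Y2 : cf2 x / 3 = y2%:~R by rewrite X2 intrM; field.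
have H0 : hess0 x = (y1 * y1 - x0 * y2)%:~R by rewrite /hess0 Y1 Y2 X0 rmorphB /= !intrM; ring.
have H1 : hess1 x = (y1 * y2 - x0 * x3)%:~R by rewrite /hess1 Y1 Y2 X0 X3 rmorphB /= !intrM; ring.
have H2 : hess2 x = (y2 * y2 - y1 * x3)%:~R by rewrite /hess2 Y1 Y2 X3 rmorphB /= !intrM; ring.
have [|bz [A [B [Cc [u [v [w [bz0 HA HB HC huvw]]]]]]]] :=
    @primitive_triple (y1 * y1 - x0 * y2) (y1 * y2 - x0 * x3) (y2 * y2 - y1 * x3).
  by apply: contraNneq h0 => -[h _ _]; rewrite H0 h.
have [b hb] : exists b : nat, bz = b by exists `|bz|%N; rewrite gtz0_abs.
have b0 : (0 < b)%N by rewrite -ltz_nat -hb.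
have bn : b%:R != 0 :> rat by rewrite pnatr_eq0 -lt0n.
rewrite HA hb intrM /= -pmulrn in H0; rewrite HB hb intrM /= -pmulrn in H1.
rewrite HC hb intrM /= -pmulrn in H2.
have An : A%:~R != 0 :> rat by apply: contraNneq h0 => h; rewrite H0 h mulr0.
have disc : m ^+ 2 * D%:~R = b%:R ^+ 2 * (B%:~R ^+ 2 - 4 * A%:~R * Cc%:~R).
  rewrite -hn; move: hdisc; rewrite cf_disc_hess H0 H1 H2 intrM => hd.
  have q27 : (-27)%:~R != 0 :> rat by [].
  by apply: (mulfI q27); rewrite -hd; ring.
(* The conductor is forced by D c^2 = B^2 - 4 A Cc; for the moment it is only a positive
   rational. *)
pose cq : rat := `|m| / b%:R.
have hcq : D%:~R * cq ^+ 2 = B%:~R ^+ 2 - 4 * A%:~R * Cc%:~R.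
  rewrite /cq expr_div_n real_normK ?num_real // mulrA [D%:~R * _]mulrC disc; field.
  by [].
have mn : m != 0.
  by apply/eqP => m0; move: hn; rewrite m0 expr0n mul0r => /eqP; rewrite intr_eq0 => /eqP.
have cq0 : 0 < cq by rewrite divr_gt0 ?normr_gt0 ?ltr0n.
(* (B + c sqrt D)/2 has trace B and norm A Cc, so maximality of the order makes both c and (B - D
   c)/2 integers. *)
have [_ _ /(_ (B%:~R / 2) (cq / 2))] := Dfund.
have -> : 2 * (B%:~R / 2) = B%:~R :> rat by field.
have -> : (B%:~R / 2) ^+ 2 - D%:~R * (cq / 2) ^+ 2 = (A * Cc)%:~R :> rat.
  rewrite intrM; have -> : D%:~R * (cq / 2) ^+ 2 = D%:~R * cq ^+ 2 / 4 by field.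
  by rewrite hcq; field.
rewrite !intr_int => /(_ isT isT)[]; have -> : 2 * (cq / 2) = cq by field.
move=> /intrP[cz hcz] /intrP[j hj].
have cz0 : 0 < cz by rewrite -(ltr0z rat) -hcz.
have [c hc] : exists c : nat, cz = c by exists `|cz|%N; rewrite gtz0_abs.
have c0 : (0 < c)%N by rewrite -ltz_nat -hc.
have cn := c_neq0 c0; have hcr : cq = c%:R by rewrite hcz hc -pmulrn.
rewrite hcr in hcq hj.
(* The ideal is Z A + Z th, where th / A is the root of the Hessian prescribed by [basis_ratio]. Its
   norm form is A (A u^2 + B u v + Cc v^2), so its norm will be |A| and the sign s that of A. *)
pose th := mkq (B%:~R / 2) (c%:R / 2); pose e := vec2 (A%:~R : k) th.
have [t ht t2] : exists2 t : int, `|A| = t * A & t * t = 1.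
  by have [h|h] := leP 0 A; [exists 1; rewrite ?mul1r ?ger0_norm | exists (-1); rewrite ?mulN1r ?ltr0_norm].
pose g : rat := `|A|%:~R; pose s : rat := t%:~R.
have gE : g = s * A%:~R by rewrite /g ht intrM.
have g0 : 0 < g by rewrite /g ltr0z normr_gt0 -(intr_eq0 rat).
have gn : g != 0 by rewrite gt_eqF.
have s2 : s ^+ 2 = 1 by rewrite expr2 -intrM t2.
have sn : s != 0 by apply/eqP => s0; move: s2; rewrite s0 expr0n => /eqP; rewrite eq_sym oner_eq0.
have gV : g^-1 = s * A%:~R^-1.
  by rewrite gE invfM; congr (_ * _); apply: (mulfI sn); rewrite mulfV // -expr2 s2.
have e0 : e 0 = A%:~R by [].
have e1 : e 1 = th by [].
have nA : nrm (e 0) = g * (t * A)%:~R by rewrite e0 nrm_intr gE intrM -/s; ring: s2.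
have nB : 2 * re (e 0 * conj (e 1)) = g * (t * B)%:~R.
  by rewrite e0 e1 gE intrM -/s /th !cE; field: s2.
have nC : nrm (e 1) = g * (t * Cc)%:~R.
  rewrite gE intrM -/s; transitivity (s ^+ 2 * (A%:~R * Cc%:~R)); last by ring.
  rewrite s2 e1 /qnorm !cE; have -> : A%:~R * Cc%:~R = (B%:~R ^+ 2 - D%:~R * c%:R ^+ 2) / 4 :> rat.
    by rewrite hcq; field.
  by field.
have hB1 : (t * u) * (t * A) + (t * v) * (t * B) + (t * w) * (t * Cc) = 1.
  transitivity (t * t * (u * A + v * B + w * Cc)); first by ring.
  by rewrite t2 huvw.
have [hmul hstab] := prim_mul g0 nA nB nC hB1.
have hO : lat 1 (ratr g^-1 * (e 0 * conj (e 1))) = @order_c k c.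
  (* The generator is conj(th) up to the sign of A, and conj(th) = j + D c - c om; so it spans O_c
     together with 1. *)
  have -> : ratr g^-1 * (e 0 * conj (e 1)) = (t * (j + D * c%:Z))%:~R - t%:~R * (c%:R * om).
    rewrite e0 e1; apply: eqC; rewrite !cE gV; last by rewrite -/s; field.
    by rewrite intrM intrD intrM -hj -pmulrn -/s; field.
  rewrite (order_c_E C Dfund) eqEsubset; split=> _ [p [q ->]].
    by exists (p + q * (t * (j + D * c%:Z))), (- (q * t)); rewrite !(intrD, rmorphN, intrM) /=; ring.
  exists (p + q * (j + D * c%:Z)), (- (q * t)).
  have tk : t%:~R * t%:~R = 1 :> k by rewrite -intrM t2.
  rewrite !(intrD, rmorphN, intrM) /=.
  transitivity (p%:~R * 1 + (t%:~R * t%:~R) * (q%:~R * (c%:R * om)) +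
     (1 - t%:~R * t%:~R) * (q%:~R * (j%:~R + D%:~R * c%:Z%:~R))).
    by rewrite tk; ring.
  by ring.
have area_e : areaC (e 0) (e 1) = s * g * c%:R / 2.
  by rewrite e0 e1 gE /th /area !cE; field: s2.
have a0 : areaC (e 0) (e 1) != 0 by rewrite area_e !mulf_neq0.
pose a := lat (e 0) (e 1).
have hna : has_norm C c a g.
  split=> //; last by rewrite hmul hO.
  split; first by apply/(is_lattice_E C); exists (e 0), (e 1).
  by rewrite -hO.
(* P and Q solve the two linear equations [T0] and [T1], and beta is then chosen so that its kappa
   is P + Q sqrt D. *)
pose P : rat := x0%:~R / (2 * A%:~R ^+ 3).
pose Q : rat := (P * B%:~R - y1%:~R / A%:~R ^+ 2) / (c%:R * D%:~R).
pose ka := mkq P Q; pose beta := ka * mkq 0 c%:R * ratr (g ^+ 3).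
have kE : kap C c g beta = ka.
  by rewrite /kap /beta /codiff /ka; apply: eqC; rewrite !cE; field; rewrite ?gn ?cn ?Dn.
have T0 : 2 * re (ka * A%:~R ^+ 3) = x0%:~R.
  by rewrite /ka /P !cE; field.
have T1 : 2 * re (ka * (A%:~R ^+ 2 * conj th)) = y1%:~R.
  by rewrite /ka /th /Q /P !cE; field; rewrite ?An ?cn ?Dn.
have thE : conj th ^+ 2 = B%:~R * conj th - (A * Cc)%:~R.
  rewrite intrM; apply: eqC; rewrite /th !cE; last by field.
  have -> : A%:~R * Cc%:~R = (B%:~R ^+ 2 - D%:~R * c%:R ^+ 2) / 4 :> rat by rewrite hcq; field.
  by field.
have mulA z : re (A%:~R * z) = A%:~R * re z by rewrite reM re_intr im_intr; ring.
have mulz (i : int) z : re (i%:~R * z) = i%:~R * re z by rewrite reM re_intr im_intr; ring.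
have apol1 : A%:~R * y2%:~R = B%:~R * y1%:~R - Cc%:~R * x0%:~R :> rat.
  apply: (mulfI bn); rewrite mulrBr !mulrA -H0 -H1 -H2 /hess0 /hess1 /hess2 Y1 Y2 X0 X3; ring.
have apol2 : A%:~R * x3%:~R = B%:~R * y2%:~R - Cc%:~R * y1%:~R :> rat.
  apply: (mulfI bn); rewrite mulrBr !mulrA -H0 -H1 -H2 /hess0 /hess1 /hess2 Y1 Y2 X0 X3; ring.
have T2 : 2 * re (ka * (A%:~R * conj th ^+ 2)) = y2%:~R.
  apply: (mulfI An); rewrite apol1 -T0 -T1 mulrCA -mulA thE.
  have -> : A%:~R * (ka * (A%:~R * (B%:~R * conj th - (A * Cc)%:~R))) =
     B%:~R * (ka * (A%:~R ^+ 2 * conj th)) - Cc%:~R * (ka * A%:~R ^+ 3).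
    by rewrite intrM; ring.
  by rewrite reD reN !mulz; ring.
have T3 : 2 * re (ka * conj th ^+ 3) = x3%:~R.
  apply: (mulfI An); rewrite apol2 -T2 -T1 mulrCA -mulA exprSr thE.
  have -> : A%:~R * (ka * ((B%:~R * conj th - (A * Cc)%:~R) * conj th)) =
     B%:~R * (ka * (A%:~R * conj th ^+ 2)) - Cc%:~R * (ka * (A%:~R ^+ 2 * conj th)).
    by rewrite intrM; ring.
  by rewrite reD reN !mulz thE; ring.
have nbeta : nrm beta = s * b%:R * g ^+ 3.
  have s3 : s * b%:R * g ^+ 3 = b%:R * A%:~R ^+ 3.
    by rewrite gE; transitivity (s ^+ 2 * s ^+ 2 * (b%:R * A%:~R ^+ 3)); [ring | rewrite s2; ring].
  have g6 : g ^+ 6 = A%:~R ^+ 6.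
    by rewrite gE; transitivity (s ^+ 2 * s ^+ 2 * s ^+ 2 * A%:~R ^+ 6); [ring | rewrite s2; ring].
  (* The value of the Hessian at (y1, -x0) is the square of its leading coefficient; dividing by b
     gives this relation. *)
  have hx : x0%:~R ^+ 2 * Cc%:~R - x0%:~R * y1%:~R * B%:~R + y1%:~R ^+ 2 * A%:~R = b%:R * A%:~R ^+ 2 :> rat.
    apply: (mulfI bn).
    transitivity (x0%:~R ^+ 2 * hess2 x - x0%:~R * y1%:~R * hess1 x + y1%:~R ^+ 2 * hess0 x).
      by rewrite H0 H1 H2; ring.
    transitivity (hess0 x ^+ 2); last by rewrite H0; ring.
    by rewrite /hess0 /hess1 /hess2 Y1 Y2 X0 X3; ring.
  rewrite s3; transitivity ((Q * c%:R * D%:~R) ^+ 2 * A%:~R ^+ 6 - P ^+ 2 * (D%:~R * c%:R ^+ 2) * A%:~R ^+ 6).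
    rewrite -g6 /beta /ka /qnorm !cE; ring.
  rewrite hcq /Q /P; transitivity (A%:~R * (x0%:~R ^+ 2 * Cc%:~R - x0%:~R * y1%:~R * B%:~R + y1%:~R ^+ 2 * A%:~R) : rat).
    by field; rewrite ?An ?cn ?Dn.
  by rewrite hx; ring.
exists b, c, a, beta, e; split=> //.
  have -> : (b * c)%:R = b%:R * c%:R :> rat by rewrite -natrM.
  by rewrite hn disc -hcq; ring.
apply/(rep_data Dfund conjE sqrtE) => //; exists g, s; split=> //; rewrite ?kE ?e0 ?e1 ?conj_int.
- apply/(mem_cubeP Dfund c0 _ hna); rewrite -/(kap C c g beta) kE e0 e1 conj_int.
  by rewrite T0 T1 T2 T3 !intr_int.
- by rewrite T0.
- by rewrite T1 X1 intrM.
- by rewrite T2 X2 intrM.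
- by rewrite T3.
Qed.

(** Well-definedness: the union over all representatives and bases in [Psi] is a single orbit. *)
Lemma Psi_rep b c a beta e x : (0 < b)%N -> (0 < c)%N -> rep b c a beta e x ->
  Psi k (b, c, [set q | Sset b c q /\ Sequiv (a, beta) q]) = Gamma_orbit x.
Proof.
move=> b0 c0 r; rewrite eqEsubset; split=> y.
  move=> [a' [beta' [e' [x' [[hS hq] ho hf hy]]]]].
  have r' : rep b c a' beta' e' x' by [].
  exact: orbit_trans (Sequiv_orbit Dfund conjE sqrtE b0 c0 r r' hq) hy.
case: (r) => hS ho hf hy; exists a, beta, e, x; split=> //.
by split=> //; exact: Sequiv_refl.
Qed.

Theorem Psi_bij (n : int) (m : rat) : n <> 0 -> n%:~R = m ^+ 2 * D%:~R ->
  set_bij (S_n k n) (Gamma_quotient (Ldual_n n)) (Psi k).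
Proof.
move=> n0 hn.
have Sn b c Cl : S_n k n (b, c, Cl) -> [/\ (0 < b)%N, (0 < c)%N,
   n%:~R = (b * c)%:R ^+ 2 * D%:~R :> rat & exists a beta e x, rep b c a beta e x /\
   Cl = [set q | Sset b c q /\ Sequiv (a, beta) q]].
  move=> [b0 c0 hd [[a beta] hS <-]]; split=> //.
    by rewrite -hd (alg_disc_E C Dfund) intrM rmorphXn /= rmorph_nat.
  have [e [x r]] := rep_exists Dfund conjE sqrtE b0 c0 hS.
  by exists a, beta, e, x.
split.
- move=> [[b c] Cl] /Sn[b0 c0 hnr [a [beta [e [x [r ->]]]]]].
  rewrite (Psi_rep b0 c0 r); exists x => //.
  have [g [s F]] := (rep_data Dfund conjE sqrtE _ _ _ _ b0 c0).1 r.
  by apply: (form_Ldual Dfund F).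
- move=> [[b1 c1] C1] [[b2 c2] C2] /set_mem/Sn[b10 c10 hn1 [a1 [beta1 [e1 [x1 [r1 ->]]]]]].
  move=> /set_mem/Sn[b20 c20 hn2 [a2 [beta2 [e2 [x2 [r2 ->]]]]]].
  rewrite (Psi_rep b10 c10 r1) (Psi_rep b20 c20 r2) => ho.
  have [g [s F]] := (rep_data Dfund conjE sqrtE _ _ _ _ b10 c10).1 r1.
  (* Both representatives are moved to one form [y] of the common orbit with nonzero leading Hessian
     coefficient; the pairs themselves stay fixed and only their bases change. *)
  have [y [o1 _ hy]] := orbit_hess0 n0 (form_Ldual Dfund F hn1).
  have o2 : Gamma_orbit x2 y by rewrite -ho.
  have [e1' r1'] := rep_orbit Dfund conjE sqrtE r1 o1.
  have [e2' r2'] := rep_orbit Dfund conjE sqrtE r2 o2.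
  have [g1 [s1 F1]] := (rep_data Dfund conjE sqrtE _ _ _ _ b10 c10).1 r1'.
  have [g2 [s2 F2]] := (rep_data Dfund conjE sqrtE _ _ _ _ b20 c20).1 r2'.
  have [eb ec] := form_bc F1 F2; subst b2 c2; congr (_, _, _).
  have h := form_Sequiv F1 F2 hy.
  rewrite eqEsubset; split=> q [hq hs]; split=> //.
    exact: Sequiv_trans (Sequiv_sym h) hs.
  exact: Sequiv_trans h hs.
move=> _ [x hx <-]; have [y [oy hy h0]] := orbit_hess0 n0 hx.
have [b [c [a [beta [e [b0 c0 hnr r]]]]]] := rep_surj hn n0 hy h0.
exists (b, c, [set q | Sset b c q /\ Sequiv (a, beta) q]); last first.
  by rewrite (Psi_rep b0 c0 r) (orbit_eq oy).
split=> //; last by exists (a, beta) => //; case: r.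
apply/eqP; rewrite -(eqr_int rat) (alg_disc_E C Dfund) intrM rmorphXn /= rmorph_nat; apply/eqP.
by rewrite hnr.
Qed.

End Main.

(** * The algebras Q + Q and Q(sqrt n) *)

Lemma disc_mod4 (D : int) : (exists k : int, D * (D - 1) = 4 * k) <->
  exists j : int, D = 4 * j \/ D = 4 * j + 1.
Proof.
split=> [[k hk]|[j [->|->]]]; last 2 first.
- by exists (j * (4 * j - 1)); ring.
- by exists (j * (4 * j + 1)); ring.
have [j [r [hD r0 r4]]] : exists j r : int, [/\ D = j * 4 + r, 0 <= r & r < 4].
  by exists (D %/ 4)%Z, (D %% 4)%Z; split; [exact: divz_eq | exact: modz_ge0 | exact: ltz_pmod].
have hr : r = 0 \/ r = 1 \/ r = 2 \/ r = 3 by clear -r0 r4; lia.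
exists j; move: hk; rewrite hD => hk.
by case: hr hk => [|[|[|]]] -> hk; [left | right | exfalso | exfalso]; lia.
Qed.

(** Write 2q = a/f in lowest terms. With t = 2p and N the norm, f^2 (t^2 - 4N) = D a^2, so f^2
    divides D; the quotient D' is again 0 or 1 mod 4, which forces f = 1. *)
Lemma fundamental_max (D : int) : D != 0 ->
  (exists k : int, D * (D - 1) = 4 * k) ->
  (forall (f : nat) (D' : int), (1 < f)%N -> D = f%:Z ^+ 2 * D' ->
     ~ exists k : int, D' * (D' - 1) = 4 * k) ->
  fundamental D.
Proof.
move=> D0 /[dup] hD4 /disc_mod4[j hj] hmax; split=> // p q /intrP[t ht] /intrP[N hN].
pose a := numq (2 * q); pose f := denq (2 * q).
have f0 : 0 < f by apply: denq_gt0.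
have hq : (2 * q) * f%:~R = a%:~R by rewrite numqE.
have cop : coprimez a f by rewrite /coprimez /gcdz (eqP (coprime_num_den _)).
have E : f ^+ 2 * (t ^+ 2 - 4 * N) = D * a ^+ 2.
  apply/eqP; rewrite -(eqr_int rat) !intrM rmorphB /= !intrM ?rmorphXn /= -hq -ht -hN.
  by apply/eqP; field.
have /dvdzP[D' hD'] : (f ^+ 2 %| D)%Z.
  rewrite -(@Gauss_dvdzl _ _ (a ^+ 2)); last by rewrite coprimezXl // coprimezXr // coprimez_sym.
  by rewrite -E dvdz_mulr.
have f2 : f ^+ 2 != 0 by rewrite expf_neq0 // gt_eqF.
have E' : t ^+ 2 - 4 * N = D' * a ^+ 2.
  by apply: (mulfI f2); rewrite E hD'; ring.
have par (z : int) : exists i : int, z = 2 * i \/ z = 2 * i + 1.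
  by exists (z %/ 2)%Z; have := divz_eq z 2; have := modz_ge0 z (isT : 2 != 0 :> int); have := ltz_pmod z (isT : 0 < 2 :> int); lia.
have [i hi] := par t; have [l hl] := par a; have [h hh] := par f.
have f1 : f = 1.
  apply/eqP; rewrite eq_le; apply/andP; split; last by lia.
  rewrite leNgt; apply/negP => f1.
  have [fn hfn] : exists fn : nat, f = fn by exists `|f|%N; rewrite gtz0_abs.
  apply: (hmax fn D'); [by lia | by rewrite hD' hfn mulrC | apply/disc_mod4].
  (* If a is even then f is odd and D' is congruent to D mod 4; if a is odd then D' is congruent to
     t^2 mod 4. *)
  case: hl => hl.
    case: hh => hh.
      have : (2 %| gcdz a f)%Z by rewrite dvdz_gcd hl hh !dvdz_mulr.
      by rewrite (eqP cop).
    exists (j - D' * h * (h + 1)); move: hj; rewrite hD' hh; case=> hj; [left|right].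
      by transitivity (D' * (2 * h + 1) ^+ 2 - 4 * (D' * h * (h + 1))); [ring | rewrite hj; ring].
    by transitivity (D' * (2 * h + 1) ^+ 2 - 4 * (D' * h * (h + 1))); [ring | rewrite hj; ring].
  have -> : D' = t ^+ 2 - 4 * N - 4 * (D' * l * (l + 1)) by rewrite E' hl; ring.
  case: hi => ->; [exists (i ^+ 2 - N - D' * l * (l + 1)); left | exists (i ^+ 2 + i - N - D' * l * (l + 1)); right]; ring.
rewrite f1 mulr1 in hq; split; first by rewrite hq intr_int.
have D'D : D' = D by rewrite hD' f1; ring.
rewrite D'D in E'.
(* The equation t^2 - 4N = D a^2 modulo 2 shows that t and D a have the same parity. *)
have [z hz] : exists z, t - D * a = 2 * z.
  case: hj => hj; case: hi => hi; case: hl => hl; rewrite hi hl hj.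
  - by exists (i - 4 * j * l); ring.
  - by exists (i - 2 * j * (2 * l + 1)); ring.
  - by exfalso; move: E'; rewrite hi hl hj; lia.
  - by exfalso; move: E'; rewrite hi hl hj; lia.
  - by exists (i - (4 * j + 1) * l); ring.
  - by exfalso; move: E'; rewrite hi hl hj; lia.
  - by exfalso; move: E'; rewrite hi hl hj; lia.
  - by exists (i - 4 * j * l - l - 2 * j); ring.
apply/intrP; exists z; have : (t - D * a)%:~R = (2 * z)%:~R :> rat by rewrite hz.
by rewrite rmorphB /= !intrM -ht -hq => h'; lra.
Qed.

Lemma fundamental1 : fundamental 1.
Proof.
apply: fundamental_max => //; first by exists 0.
move=> f D' f1 h _; have : (f%:Z ^+ 2 %| 1)%Z by apply/dvdzP; exists D'; rewrite mulrC.
by rewrite dvdz1 abszX => /eqP; nia.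
Qed.

(** The order of the two coordinates is the one for which sqrt 1 is the prescribed (-1, 1). *)
Definition split_coord : quad_coord (rat * rat)%type 1.
Proof.
refine (@QuadCoord _ 1 (fun x : rat * rat => (x.1 + x.2) / 2) (fun x => (x.2 - x.1) / 2)
  (fun p q => (p - q, p + q)) _ _ _ _ _ _ _ _ _).
- by case=> x y /=; congr (_, _); field.
- by move=> p q /=; field.
- by move=> p q /=; field.
- by rewrite /=; field.
- by rewrite /=; field.
- by case=> a b [c d] /=; field.
- by case=> a b [c d] /=; field.
- by case=> a b [c d] /=; field.
- by case=> a b [c d] /=; field.
Defined.

Lemma split_bij (n : int) : n <> 0 -> (exists m : int, n = m ^+ 2) ->
  set_bij (S_n split_alg n) (Gamma_quotient (Ldual_n n)) (Psi split_alg).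
Proof.
move=> n0 [m hm]; apply: (@Psi_bij split_alg 1 split_coord fundamental1 _ _ n m%:~R) => //.
  by case=> x y /=; rewrite /conj /=; congr (_, _); field.
by rewrite hm rmorphXn mulr1.
Qed.

(* The square class of n contains a fundamental discriminant: take the largest
   f such that 4n / f^2 is an integer congruent to 0 or 1 mod 4. *)
Lemma fundamental_exists (n : int) : n != 0 ->
  exists (D : int) (m : rat), fundamental D /\ n%:~R = m ^+ 2 * D%:~R.
Proof.
move=> n0; pose P (f : nat) := (0 < f)%N && `[< exists D : int, 4 * n = f%:Z ^+ 2 * D /\
   exists k : int, D * (D - 1) = 4 * k >].
have ex : exists f, P f.
  exists 1%N; apply/andP; split=> //; apply/asboolP; exists (4 * n); split; first by ring.
  by exists (n * (4 * n - 1)); ring.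
have bnd f : P f -> (f <= `|(4 * n)%R|)%N.
  move=> /andP[f0 /asboolP[D [h _]]]; rewrite h abszM abszX absz_nat.
  have : D != 0 by apply: contraNneq n0 => D0; move: h; rewrite D0 mulr0 => /eqP; rewrite mulf_eq0.
  rewrite -absz_gt0 => d0; nia.
have [f /andP[f0 /asboolP[D [hD hk]]] fmax] := ex_maxnP ex bnd.
exists D, (f%:R / 2); split.
  apply: fundamental_max => //.
    by apply: contraNneq n0 => D0; move: hD; rewrite D0 mulr0 => /eqP; rewrite mulf_eq0.
  move=> f' D' f1 h hk'; have : P (f * f')%N.
    apply/andP; split; first by rewrite muln_gt0 f0 ltnW.
    by apply/asboolP; exists D'; split=> //; rewrite hD h PoszM; ring.
  by move=> /fmax; rewrite leqNgt ltn_Pmulr.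
have : (4 * n)%:~R = (f%:Z ^+ 2 * D)%:~R :> rat by rewrite hD.
rewrite !intrM ?rmorphXn /= -?pmulrn => h;
by apply: (@mulfI _ 4) => //; rewrite h; field.
Qed.

Lemma int_sqrt_rat (n : int) (r : rat) : n%:~R = r ^+ 2 -> exists m : int, n = m ^+ 2.
Proof.
move=> h; exists (numq r).
have E : n * denq r ^+ 2 = numq r ^+ 2.
  apply/eqP; rewrite -(eqr_int rat) intrM !rmorphXn /= h numqE; apply/eqP; ring.
have cop : coprimez (numq r ^+ 2) (denq r ^+ 2).
  by rewrite coprimezXl // coprimezXr // /coprimez /gcdz (eqP (coprime_num_den _)).
have d1 : (denq r ^+ 2 %| numq r ^+ 2)%Z by rewrite -E dvdz_mull.
have : (denq r ^+ 2 %| gcdz (numq r ^+ 2) (denq r ^+ 2))%Z by rewrite dvdz_gcd d1 dvdzz.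
rewrite (eqP cop) dvdz1 abszX => /eqP hd.
have d0 := denq_gt0 r; have dd : denq r = 1 by nia.
by rewrite -E dd; ring.
Qed.

(** * Coordinates and automorphisms of a quadratic field *)

Section QuadField.
Variables (L : fieldType) (inL : {rmorphism rat -> L}) (D : int) (dl : L).
Hypothesis dl2 : dl ^+ 2 = D%:~R.
Hypothesis Dnsq : forall r : rat, D%:~R != r ^+ 2.
Hypothesis span : forall x : L, exists pq : rat * rat, x = inL pq.1 + inL pq.2 * dl.

Definition field_pq (x : L) : rat * rat :=
  xget (0, 0) [set pq : rat * rat | x = inL pq.1 + inL pq.2 * dl].

Lemma field_pqP x : x = inL (field_pq x).1 + inL (field_pq x).2 * dl.
Proof. exact: (xgetPex (0, 0) (span x)). Qed.

(** Two different expressions would make [dl] rational and D a square. *)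
Lemma field_pq_uniq (p q p' q' : rat) :
  inL p + inL q * dl = inL p' + inL q' * dl -> p = p' /\ q = q'.
Proof.
move=> h; have h' : inL (p - p') = inL (q' - q) * dl.
  apply/eqP; rewrite -subr_eq0; move/eqP: h; rewrite -subr_eq0 => /eqP h.
  by apply/eqP; rewrite -[RHS]h !rmorphB; ring.
have qq : q' - q = 0.
  apply/eqP/negPn/negP => qn; have /negP := Dnsq ((p - p') / (q' - q)); apply.
  have hdl : dl = inL ((p - p') / (q' - q)).
    by rewrite fmorph_div h' mulrC mulKf // fmorph_eq0.
  by apply/eqP/(fmorph_inj inL); rewrite rmorph_int -dl2 hdl rmorphXn.
move: h'; rewrite qq rmorph0 mul0r => /eqP; rewrite fmorph_eq0 subr_eq0 => /eqP ->.
by move/eqP: qq; rewrite subr_eq0 => /eqP ->.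
Qed.

Lemma field_pqE (p q : rat) : field_pq (inL p + inL q * dl) = (p, q).
Proof.
have [] := field_pq_uniq (esym (field_pqP (inL p + inL q * dl))).
by case: (field_pq _) => a b /= -> ->.
Qed.

Lemma field_pqD x y : field_pq (x + y) =
  ((field_pq x).1 + (field_pq y).1, (field_pq x).2 + (field_pq y).2).
Proof.
rewrite -field_pqE {1}(field_pqP x) {1}(field_pqP y) !rmorphD.
by congr field_pq; ring.
Qed.

Lemma field_pqM x y : field_pq (x * y) =
  ((field_pq x).1 * (field_pq y).1 + D%:~R * ((field_pq x).2 * (field_pq y).2),
   (field_pq x).1 * (field_pq y).2 + (field_pq x).2 * (field_pq y).1).
Proof.
rewrite -field_pqE {1}(field_pqP x) {1}(field_pqP y) !rmorphD !rmorphM rmorph_int -dl2.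
by congr field_pq; ring.
Qed.

Lemma field_pq1 : field_pq 1 = (1, 0).
Proof. by rewrite -field_pqE rmorph0 rmorph1 mul0r addr0. Qed.

Definition field_coord : quad_coord L D.
Proof.
refine (@QuadCoord _ D (fun x => (field_pq x).1) (fun x => (field_pq x).2)
  (fun p q => inL p + inL q * dl) _ _ _ _ _ _ _ _ _).
- by move=> x; rewrite -field_pqP.
- by move=> p q; rewrite field_pqE.
- by move=> p q; rewrite field_pqE.
- by rewrite field_pq1.
- by rewrite field_pq1.
- by move=> x y; rewrite field_pqD.
- by move=> x y; rewrite field_pqD.
- by move=> x y; rewrite field_pqM.
- by move=> x y; rewrite field_pqM.
Defined.

(** A ring endomorphism fixes Q and sends [dl] to a square root of D; this pins down the
    automorphism that [Qsqrt_conj] obtains by choice. *)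
Lemma field_auto (f : L -> L) : GRing.zmod_morphism f -> monoid_morphism f ->
  (forall x, f x = x) \/ forall x, f x = conj field_coord x.
Proof.
move=> fB fM; pose F : {rmorphism L -> L} := HB.pack f
  (GRing.isZmodMorphism.Build _ _ f fB) (GRing.isMonoidMorphism.Build _ _ f fM).
have fin q : F (inL q) = inL q.
  by rewrite (fmorph_eq_rat inL) fmorph_rat.
have fE x : F x = inL (field_pq x).1 + inL (field_pq x).2 * F dl.
  by rewrite {1}(field_pqP x) rmorphD rmorphM !fin.
have : (F dl) ^+ 2 == dl ^+ 2 by rewrite -rmorphXn dl2 rmorph_int.
rewrite eqf_sqr => /orP[/eqP h|/eqP h]; [left | right] => x.
  by rewrite -[LHS]/(F x) fE h -field_pqP.
by rewrite -[LHS]/(F x) fE h /conj /= rmorphN mulNr mulrN.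
Qed.

Lemma field_dl : mkq field_coord 0 1 = dl.
Proof. by rewrite /= rmorph0 rmorph1 add0r mul1r. Qed.

End QuadField.

(** The Horner scheme stays in the span of 1 and s, since (u + v s) s + a = (v r + a) + u s. *)
Lemma horner_sqrt (L : fieldType) (inL : {rmorphism rat -> L}) (s : L) (r : rat)
    (p : {poly rat}) : s ^+ 2 = inL r ->
  exists uv : rat * rat, (map_poly inL p).[s] = inL uv.1 + inL uv.2 * s.
Proof.
move=> s2; elim/poly_ind: p => [|p a [[u v] IH]].
  by exists (0, 0); rewrite /= rmorph0 horner0 rmorph0 mul0r addr0.
exists (v * r + a, u).
rewrite rmorphD rmorphM /= map_polyX map_polyC !hornerE IH /= rmorphD rmorphM -s2.
by ring.
Qed.

Lemma Qsqrt_gen (n : int) : exists (inL : {rmorphism rat -> Qsqrt n}) (s : Qsqrt n),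
  s ^+ 2 = n%:~R /\
  forall x : Qsqrt n, exists pq : rat * rat, x = inL pq.1 + inL pq.2 * s.
Proof.
rewrite /Qsqrt; case: (num_field_exists _) => L [emb [[|s [|? ?]] //= [hs] hfull]].
have s2 : s ^+ 2 = n%:~R.
  by apply: (fmorph_inj emb); rewrite rmorphXn /= hs sqrtCK rmorph_int.
exists (in_alg L), s; split=> // x; have : x \in <<1; s>>%VS.
  have -> : <<1; s>>%VS = <<1 & [:: s]>>%VS by rewrite adjoin_seq1.
  by rewrite hfull memvf.
by move=> /Fadjoin1_polyP[p ->]; apply: (@horner_sqrt _ _ _ n%:~R); rewrite rmorph_int.
Qed.

Lemma field_bij (n : int) : n <> 0 -> ~ (exists m : int, n = m ^+ 2) ->
  set_bij (S_n (field_alg n) n) (Gamma_quotient (Ldual_n n)) (Psi (field_alg n)).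
Proof.
move=> /eqP n0 nsq; have [D [m [Df hm]]] := fundamental_exists n0.
have mn : m != 0.
  by apply: contraNneq n0 => m0; move: hm; rewrite m0 expr0n mul0r => /eqP; rewrite intr_eq0.
have Dnsq r : D%:~R != r ^+ 2 :> rat.
  by apply/eqP => h; apply: nsq; apply: (@int_sqrt_rat _ (m * r)); rewrite hm h; ring.
have [inL [s [s2 sspan]]] := Qsqrt_gen n.
(* A provisional root of D, correct up to sign. The prescribed root is defined through [alg_disc],
   which must first be computed in some coordinates; the coordinates are then rebuilt on the
   prescribed root. *)
pose dl0 : Qsqrt n := inL m^-1 * s.
have dl02 : dl0 ^+ 2 = D%:~R.
  rewrite /dl0 exprMn s2 -(rmorph_int inL n) -rmorphXn -rmorphM hm.
  by rewrite -(rmorph_int inL D); congr (inL _); field.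
have span0 x : exists pq : rat * rat, x = inL pq.1 + inL pq.2 * dl0.
  have [[p q] ->] := sspan x; exists (p, q * m); rewrite /dl0 /= mulrA -rmorphM.
  by congr (_ + inL _ * _); field.
have aD : alg_disc (Qsqrt n) = D := alg_disc_E (field_coord dl02 Dnsq span0) Df.
pose dl := Qsqrt_sqrtD n.
have dl2 : dl ^+ 2 = D%:~R.
  apply: (fmorph_inj (Qsqrt_emb n)); rewrite rmorphXn rmorph_int.
  have -> : Qsqrt_emb n dl = sqrtC (D%:~R : algC).
    rewrite /dl /Qsqrt_sqrtD -aD.
    apply: (@xgetPex _ 0 [set d | Qsqrt_emb n d = sqrtC ((alg_disc (Qsqrt n))%:~R : algC)]).
    have : Qsqrt_emb n dl0 ^+ 2 == sqrtC (D%:~R : algC) ^+ 2.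
      by rewrite -rmorphXn dl02 rmorph_int sqrtCK.
    rewrite eqf_sqr => /orP[/eqP h|/eqP h]; first by exists dl0; rewrite /= aD.
    by exists (- dl0); rewrite /= aD rmorphN h opprK.
  by rewrite sqrtCK.
have span x : exists pq : rat * rat, x = inL pq.1 + inL pq.2 * dl.
  have [[p q] ->] := span0 x; have : dl0 ^+ 2 == dl ^+ 2 by rewrite dl02 dl2.
  rewrite eqf_sqr => /orP[/eqP ->|/eqP ->]; first by exists (p, q).
  by exists (p, - q); rewrite /= rmorphN mulNr mulrN.
pose C := field_coord dl2 Dnsq span.
have dlK : mkq C 0 1 = dl := field_dl dl2 Dnsq span.
have hconj : Qsqrt_conj (n := n) = conj C.
  pose Au := [set f : Qsqrt n -> Qsqrt n |
    [/\ GRing.zmod_morphism f, monoid_morphism f, bijective f & f <> idfun]].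
  have Auc : Au (conj C).
    split.
    - by move=> x y; rewrite (conjD C) (conjN C).
    - split; last exact: (conjM C).
      by apply: (@eq_coord _ _ C); rewrite !cE ?oppr0.
    - by exists (conj C); exact: (conjK C).
    - move=> h; have : im C (conj C dl) = im C dl by rewrite h.
      by rewrite -dlK im_conj im_mkq.
  apply: xget_unique => // f [fB fM _ fid].
  have [h|h] := field_auto dl2 Dnsq span fB fM; last by apply/funext.
  by case: fid; apply/funext.
apply: (@Psi_bij (field_alg n) D C Df _ _ n m) => //.
- by move=> x; rewrite /= hconj.
- exact/eqP.
Qed.

Theorem theorem3p1 (n : int) (hn : n <> 0) :
  set_bij (S_n (quad_alg_of n) n) (Gamma_quotient (Ldual_n n))
          (Psi (quad_alg_of n)).
Proof.
rewrite /quad_alg_of; case: asboolP => sq; first exact: split_bij.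
exact: field_bij.
Qed.
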